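(* Let $K$ be a (discrete) field and let $R_{=0}$, $R_{\neq0}$ be two finite families of polynomials of $K[x_1,\dots,x_n]$. There is an algorithm deciding whether the presentation $\mathcal{DG}(K)\cup(\{x_1,\dots,x_n\};R_{=0},R_{\neq0})$ collapses in the theory of algebraically closed fields. In case of a positive answer one can produce an equality in $K[x_1,\dots,x_n]$ $$m=a_1p_1+\cdots+a_kp_k$$ with $p_1,\dots,p_k\in R_{=0}$, $a_1,\dots,a_k\in K[x_1,\dots,x_n]$, and $m$ in the multiplicative monoid $\mathcal M_{\neq0}$ generated by $R_{\neq0}$.
   Context: Discrete: one can decide whether an element of the field is zero. Language of fields $\mathcal L_f$: constants $0,1,-1$, operations $+,\times$, and two unary relation symbols ''$=0$'' and ''$\neq0$''. Terms over a set of variables $G$ are identified with polynomials in $\mathbb Z[G]$. A presentation $(G;R_{=0},R_{\neq0})$ is a set $G$ of variables (generators) and two subsets of $\mathbb Z[G]$, with relations $p=0$ for $p\in R_{=0}$ and $p\neq0$ for $p\in R_{\neq0}$. The diagram $\mathcal{DG}(K)$ of a field $K$ is the presentation with one generator $X_a$ for each $a\in K$ and as relations all formulas $P(X_{a_1},\dots,X_{a_r})=0$, resp. $\neq0$ ($P$ an integer polynomial) true in $K$. In $\mathcal{DG}(K)\cup(\{x_1,\dots,x_n\};R_{=0},R_{\neq0})$ one adds the new generators $x_i$ and the relations $p=0$ ($p\in R_{=0}$), $q\neq0$ ($q\in R_{\neq0}$), each coefficient $a\in K$ being replaced by $X_a$. Theory of algebraically closed fields (axioms): $\vdash 0=0$;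 $x=0,y=0\vdash x+y=0$; $x=0\vdash xy=0$; $x=0,y\neq0\vdash x+y\neq0$; $x\neq0,y\neq0\vdash xy\neq0$; $\vdash1\neq0$; $0\neq0\vdash\bot$; $xy-1=0\vdash x\neq0$; $x\neq0\vdash\exists y\ xy-1=0$; $\vdash x=0\vee x\neq0$; and for each $n\ge1$, $\vdash\exists y\ y^n+x_{n-1}y^{n-1}+\cdots+x_1y+x_0=0$. Covering: a covering of a presentation $(G;R)$ in a theory given by such axioms (each of the form $H(\mathbf x)\vdash\exists\mathbf y_1A_1(\mathbf x,\mathbf y_1)\vee\cdots\vee\exists\mathbf y_kA_k(\mathbf x,\mathbf y_k)$ with $H,A_i$ conjunctions of atomic formulas, $k\ge0$, the case $k=0$ being written $\bot$) is a finite tree whose nodes $n$ carry presentations $(G_n;R_n)$. At the root one has $(G;R)$ plus finitely many consequences of $R$ under the algebraic axioms (those with a single atomic formula and no $\exists$ on the right). At a node $n$, if $\mathbf t$ is a list of terms over $G_n$ and all conjuncts of $H(\mathbf t)$ are in $R_n$, one may create $k$ children, the $i$-th with generators $G_n\cup\{\mathbf z_i\}$ ($\mathbf z_i$ new variables) and relations $R_n\cup\{A_i(\mathbf t,\mathbf z_i)\}$ plus finitely many consequences under algebraic axioms. A branch ended by an application of an axiom with $k=0$ is dead. A collapse of $(G;R)$ is a covering all of whose branches are dead; then $(G;R)$ is said to collapse. *)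

(* Defs.v *)
From Stdlib Require List.
From HB Require Import structures.
From mathcomp Require Import all_boot all_algebra.
From mathcomp Require Import finmap.
From mathcomp Require monalg.
From mathcomp Require Import mpoly.

Set Implicit Arguments.
Unset Strict Implicit.
Unset Printing Implicit Defensive.

Import GRing.Theory.
Local Open Scope ring_scope.

(* ------------------------------------------------------------------------ *)
(* Terms, and integer polynomials over an arbitrary set of variables        *)
(* ------------------------------------------------------------------------ *)

Inductive term (X : Type) : Type :=
| TVar of X
| TZero
| TOne
| TMinusOne
| TAdd of term X & term X
| TMul of term X & term X.

Arguments TZero {X}.
Arguments TOne {X}.
Arguments TMinusOne {X}.

Fixpoint teval (X : Type) (A : nzRingType) (nu : X -> A) (t : term X) : A :=
  match t with
  | TVar x => nu x
  | TZero => 0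
  | TOne => 1
  | TMinusOne => -1
  | TAdd t1 t2 => teval nu t1 + teval nu t2
  | TMul t1 t2 => teval nu t1 * teval nu t2
  end.

Fixpoint tpow (X : Type) (t : term X) (k : nat) : term X :=
  if k is k'.+1 then TMul t (tpow t k') else TOne.

(* [monalg] is imported only here: its notation for polynomials in n variables
   shadows that of [mpoly]. *)
Module IntegerPolynomials.

Import monalg.

Definition Zpoly (G : choiceType) : comNzRingType := {malg int[{cmonom G}]}.

Definition Zvar (G : choiceType) (g : G) : Zpoly G :=
  (mkmalgU (ucm g) 1 : {malg int[{cmonom G}]}).

Definition zeval (G : choiceType) (A : comNzRingType) (nu : G -> A)
    (p : Zpoly G) : A :=
  monalg.mmap (fun c : int => c%:~R)
    (fun m : {cmonom G} => \prod_(g <- finsupp m) nu g ^+ m g)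
    (p : {malg int[{cmonom G}]}).

End IntegerPolynomials.

Export IntegerPolynomials.

Notation "'ZZ[' G ]" := (Zpoly G)
  (at level 0, G at level 99, format "'ZZ[' G ]") : type_scope.

Definition zrename (G H : choiceType) (f : G -> H) (p : ZZ[G]) : ZZ[H] :=
  zeval (fun g => Zvar (f g)) p.

(* ------------------------------------------------------------------------ *)
(* Presentations and theories                                               *)
(* ------------------------------------------------------------------------ *)

(* [Eq0 p] is "p = 0" and [Neq0 p] is "p <> 0": two independent predicate
   symbols of the language. *)
Inductive atom (T : Type) : Type := Eq0 of T | Neq0 of T.

Definition amap (S T : Type) (f : S -> T) (a : atom S) : atom T :=
  match a with Eq0 p => Eq0 (f p) | Neq0 p => Neq0 (f p) end.

(* The generators are all the elements of [G]; [P (Eq0 p)] means that p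
   belongs to R_{=0}, and [P (Neq0 p)] that p belongs to R_{<>0}. *)
Definition presentation (G : choiceType) : Type := atom ZZ[G] -> Prop.

Definition enrich (G : choiceType) (P : presentation G) (l : seq (atom ZZ[G])) :
    presentation G :=
  fun a => P a \/ List.In a l.

(* A disjunct "exists y_0 .. y_(k-1), A(x, y)": the variables x_i are
   [inl i] with [i : nat], the variables y_j are [inr j] with [j : 'I_k]. *)
Record disjunct : Type := Disjunct {
  d_num : nat;
  d_body : seq (atom (term (nat + 'I_d_num)))
}.

(* H(x) |- D_1 \/ .. \/ D_k ; the empty list of disjuncts is falsity. *)
Record daxiom : Type := DAxiom {
  ax_hyps : seq (atom (term nat));
  ax_concl : seq disjunct
}.

Definition dtheory : Type := daxiom -> Prop.

Definition single (a : atom (term (nat + 'I_0))) : disjunct :=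
  @Disjunct 0 [:: a].

(* In an axiom instance, [t i] is the term substituted for x_i; an axiom
   mentions finitely many x_i, so only finitely many values of t matter. *)
Definition hyp_inst (G : choiceType) (t : nat -> ZZ[G]) (h : atom (term nat)) :
    atom ZZ[G] :=
  amap (teval t) h.

Definition single_inst (G : choiceType) (t : nat -> ZZ[G])
    (a : atom (term (nat + 'I_0))) : atom ZZ[G] :=
  amap (teval (fun v => match v with inl i => t i | inr _ => 0 end)) a.

(* The closure of P under the algebraic axioms, i.e. those whose right-hand side
   is a single atom without existential quantifier. *)
Inductive consequence (T : dtheory) (G : choiceType) (P : presentation G) :
    atom ZZ[G] -> Prop :=
| consequence_rel a : P a -> consequence T P a
| consequence_ax ax b (t : nat -> ZZ[G]) :
    T ax -> ax_concl ax = [:: single b] ->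
    (forall h, List.In h (ax_hyps ax) -> consequence T P (hyp_inst t h)) ->
    consequence T P (single_inst t b).

Definition consequences (T : dtheory) (G : choiceType) (P : presentation G)
    (l : seq (atom ZZ[G])) : Prop :=
  forall a, List.In a l -> consequence T P a.

(* (G + {z_0 .. z_(k-1)}; R + A(t, z)), the new variables being the elements
   of the right summand of [G + 'I_k]. *)
Definition disj_inst (G : choiceType) (t : nat -> ZZ[G]) (D : disjunct)
    (b : atom (term (nat + 'I_(d_num D)))) :
    atom ZZ[(G + 'I_(d_num D))%type] :=
  amap (teval (fun v => match v with
                        | inl i => zrename inl (t i)
                        | inr j => Zvar (inr j)
                        end)) b.

Definition adjoin (G : choiceType) (P : presentation G) (t : nat -> ZZ[G])
    (D : disjunct) : presentation (G + 'I_(d_num D))%type :=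
  fun a =>
    (exists2 b, P b & a = amap (zrename inl) b)
    \/ List.In a (map (@disj_inst G t D) (d_body D)).

Arguments adjoin [G] P t D _.

(* [ctree T P] is the type of the finite trees whose root carries P;
   [cforest T P t Ds] is the list of the subtrees created at a node carrying P
   by an axiom instance with disjuncts Ds. *)
Inductive ctree (T : dtheory) (G : choiceType) (P : presentation G) : Type :=
| CLeaf
| CNode (ax : daxiom) (t : nat -> ZZ[G]) of
    T ax &
    (forall h, List.In h (ax_hyps ax) -> P (hyp_inst t h)) &
    cforest T P t (ax_concl ax)
with cforest (T : dtheory) (G : choiceType) (P : presentation G) :
    (nat -> ZZ[G]) -> seq disjunct -> Type :=
| CNil (t : nat -> ZZ[G]) : cforest T P t [::]
| CCons (t : nat -> ZZ[G]) (D : disjunct) (Ds : seq disjunct)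
    (l : seq (atom ZZ[(G + 'I_(d_num D))%type])) :
    consequences T (adjoin P t D) l ->
    ctree T (enrich (adjoin P t D) l) ->
    cforest T P t Ds ->
    cforest T P t (D :: Ds).

Record covering (T : dtheory) (G : choiceType) (P : presentation G) : Type :=
  Covering {
    cov_added : seq (atom ZZ[G]);
    cov_addedP : consequences T P cov_added;
    cov_tree : ctree T (enrich P cov_added)
  }.

(* Every branch ends at a node without children created by an axiom with an
   empty right-hand side, and none at a [CLeaf]. *)
Fixpoint all_dead (T : dtheory) (G : choiceType) (P : presentation G)
    (c : ctree T P) : bool :=
  match c with
  | CLeaf => false
  | CNode _ _ _ _ f => all_dead_forest f
  end
with all_dead_forest (T : dtheory) (G : choiceType) (P : presentation G)
    (t : nat -> ZZ[G]) (Ds : seq disjunct) (f : cforest T P t Ds) : bool :=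
  match f with
  | CNil _ => true
  | CCons _ _ _ _ _ c f' => all_dead c && all_dead_forest f'
  end.

Definition collapses (T : dtheory) (G : choiceType) (P : presentation G) : Prop :=
  exists c : covering T P, all_dead (cov_tree c).

(* ------------------------------------------------------------------------ *)
(* The theory of algebraically closed fields                                *)
(* ------------------------------------------------------------------------ *)

Definition hX : term nat := TVar 0%N.
Definition hY : term nat := TVar 1%N.
Definition cX {k : nat} (i : nat) : term (nat + 'I_k) := TVar (inl i).
Definition cY : term (nat + 'I_1) := TVar (inr ord0).

(* y^n + x_(n-1) y^(n-1) + .. + x_1 y + x_0 *)
Definition monic_term (n : nat) : term (nat + 'I_1) :=
  foldr (fun i s => TAdd s (TMul (cX i) (tpow cY i))) (tpow cY n) (iota 0 n).

Inductive ACF : dtheory :=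
| ACF_zero :
    ACF (DAxiom [::] [:: single (Eq0 TZero)])
| ACF_add :
    ACF (DAxiom [:: Eq0 hX; Eq0 hY] [:: single (Eq0 (TAdd (cX 0) (cX 1)))])
| ACF_mul :
    ACF (DAxiom [:: Eq0 hX] [:: single (Eq0 (TMul (cX 0) (cX 1)))])
| ACF_add_neq :
    ACF (DAxiom [:: Eq0 hX; Neq0 hY] [:: single (Neq0 (TAdd (cX 0) (cX 1)))])
| ACF_mul_neq :
    ACF (DAxiom [:: Neq0 hX; Neq0 hY] [:: single (Neq0 (TMul (cX 0) (cX 1)))])
| ACF_one :
    ACF (DAxiom [::] [:: single (Neq0 TOne)])
| ACF_bot :
    ACF (DAxiom [:: Neq0 TZero] [::])
| ACF_unit :
    ACF (DAxiom [:: Eq0 (TAdd (TMul hX hY) TMinusOne)] [:: single (Neq0 (cX 0))])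
| ACF_inv :
    ACF (DAxiom [:: Neq0 hX]
           [:: @Disjunct 1 [:: Eq0 (TAdd (TMul (cX 0) cY) TMinusOne)]])
| ACF_discrete :
    ACF (DAxiom [::] [:: single (Eq0 (cX 0)); single (Neq0 (cX 0))])
| ACF_root (n : nat) : (1 <= n)%N ->
    ACF (DAxiom [::] [:: @Disjunct 1 [:: Eq0 (monic_term n)]]).

(* ------------------------------------------------------------------------ *)
(* The presentation DG(K) + ({x_1 .. x_n}; R_{=0}, R_{<>0})                 *)
(* ------------------------------------------------------------------------ *)

Definition diagram (K : fieldType) : presentation K :=
  fun a =>
    match a with
    | Eq0 p => zeval (fun c : K => c) p = 0
    | Neq0 p => zeval (fun c : K => c) p <> 0
    end.

(* Each coefficient c becomes the generator X_c = [inl c], and each x_i the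
   generator [inr i]. *)
Definition lift_poly (K : fieldType) (n : nat) (p : {mpoly K[n]}) :
    ZZ[(K + 'I_n)%type] :=
  mpoly.mmap (fun c => Zvar (inl c)) (fun i => Zvar (inr i)) p.

Definition dg_presentation (K : fieldType) (n : nat)
    (R0 Rn0 : seq {mpoly K[n]}) : presentation (K + 'I_n)%type :=
  fun a =>
    (exists2 b, diagram b & a = amap (zrename inl) b)
    \/ match a with
       | Eq0 p => exists2 q, q \in R0 & p = lift_poly q
       | Neq0 p => exists2 q, q \in Rn0 & p = lift_poly q
       end.

(* ------------------------------------------------------------------------ *)
(* Algorithms over a discrete field                                         *)
(* ------------------------------------------------------------------------ *)

(* Goedel's system T with products, options and lists, extended by a sort for
   the elements of a field, the field operations and the zero test.  In the
   presence of classical axioms the informative disjunction {P} + {~ P} has no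
   algorithmic content, hence this syntactic notion. *)
Inductive sort : Type :=
| SNat
| SFld
| SProd of sort & sort
| SOpt of sort
| SList of sort
| SArr of sort & sort.

Fixpoint interp (K : fieldType) (s : sort) : Type :=
  match s with
  | SNat => nat
  | SFld => K
  | SProd s1 s2 => (interp K s1 * interp K s2)%type
  | SOpt s1 => option (interp K s1)
  | SList s1 => seq (interp K s1)
  | SArr s1 s2 => interp K s1 -> interp K s2
  end.

Inductive pvar : seq sort -> sort -> Type :=
| PVz G s : pvar (s :: G) s
| PVs G s s' : pvar G s -> pvar (s' :: G) s.

Inductive prog : seq sort -> sort -> Type :=
| PVar G s : pvar G s -> prog G s
| PLam G s1 s2 : prog (s1 :: G) s2 -> prog G (SArr s1 s2)
| PApp G s1 s2 : prog G (SArr s1 s2) -> prog G s1 -> prog G s2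
| PZero G : prog G SNat
| PSucc G : prog G (SArr SNat SNat)
| PNatRec G s :
    prog G (SArr s (SArr (SArr SNat (SArr s s)) (SArr SNat s)))
| PPair G s1 s2 : prog G (SArr s1 (SArr s2 (SProd s1 s2)))
| PFst G s1 s2 : prog G (SArr (SProd s1 s2) s1)
| PSnd G s1 s2 : prog G (SArr (SProd s1 s2) s2)
| PNone G s : prog G (SOpt s)
| PSome G s : prog G (SArr s (SOpt s))
| POptCase G s s' : prog G (SArr s' (SArr (SArr s s') (SArr (SOpt s) s')))
| PNil G s : prog G (SList s)
| PCons G s : prog G (SArr s (SArr (SList s) (SList s)))
| PListRec G s s' :
    prog G (SArr s' (SArr (SArr s (SArr (SList s) (SArr s' s')))
                          (SArr (SList s) s')))
| PFZero G : prog G SFld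
| PFOne G : prog G SFld
| PFAdd G : prog G (SArr SFld (SArr SFld SFld))
| PFOpp G : prog G (SArr SFld SFld)
| PFMul G : prog G (SArr SFld (SArr SFld SFld))
| PFInv G : prog G (SArr SFld SFld)
| PFIsZero G s : prog G (SArr SFld (SArr s (SArr s s))).

Fixpoint penv (K : fieldType) (G : seq sort) : Type :=
  if G is s :: G' then (interp K s * penv K G')%type else unit.

Fixpoint pvar_eval (K : fieldType) G s (x : pvar G s) :
    penv K G -> interp K s :=
  match x with
  | PVz _ _ => fun e => e.1
  | PVs _ _ _ y => fun e => pvar_eval y e.2
  end.

Fixpoint prog_eval (K : fieldType) G s (p : prog G s) :
    penv K G -> interp K s :=
  match p with
  | PVar _ _ x => fun e => pvar_eval x e
  | PLam _ _ _ b => fun e v => prog_eval b (v, e)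
  | PApp _ _ _ f a => fun e => (prog_eval f e) (prog_eval a e)
  | PZero _ => fun _ => 0%N
  | PSucc _ => fun _ k => k.+1
  | PNatRec _ s => fun _ z f k => nat_rect (fun _ => interp K s) z f k
  | PPair _ _ _ => fun _ a b => (a, b)
  | PFst _ _ _ => fun _ ab => ab.1
  | PSnd _ _ _ => fun _ ab => ab.2
  | PNone _ _ => fun _ => None
  | PSome _ _ => fun _ a => Some a
  | POptCase _ _ _ => fun _ z f o => if o is Some a then f a else z
  | PNil _ _ => fun _ => [::]
  | PCons _ _ => fun _ a l => a :: l
  | PListRec _ _ s' => fun _ z f l => list_rect (fun _ => interp K s') z f l
  | PFZero _ => fun _ => 0
  | PFOne _ => fun _ => 1
  | PFAdd _ => fun _ a b => a + b
  | PFOpp _ => fun _ a => - a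
  | PFMul _ => fun _ a b => a * b
  | PFInv _ => fun _ a => a^-1
  | PFIsZero _ _ => fun _ a u v => if a == 0 then u else v
  end.

(* Kleene normal form: a program is run on 0, 1, 2, .. until it returns an
   answer, so that unbounded search is available. *)
Definition algorithm (s1 s2 : sort) : Type :=
  prog [::] (SArr SNat (SArr s1 (SOpt s2))).

Definition computes (s1 s2 : sort) (A : algorithm s1 s2) (K : fieldType)
    (x : interp K s1) (y : interp K s2) : Prop :=
  exists N : nat,
    @prog_eval K _ _ A tt N x = Some y /\
    forall i : nat, (i < N)%N -> @prog_eval K _ _ A tt i x = None.

(* A polynomial is presented to an algorithm as a list of pairs (exponents,
   coefficient), with no normalization: monomials may be repeated, coefficients
   may vanish, and lists of exponents are truncated or padded with 0. *)
Definition SPoly : sort := SList (SProd (SList SNat) SFld).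

Definition decode (K : fieldType) (n : nat) (r : interp K SPoly) : {mpoly K[n]} :=
  \sum_(mc <- (r : seq (seq nat * K)))
    mc.2 *: 'X_[[multinom nth 0%N mc.1 i | i < n]].

Lemma decode_surj (K : fieldType) (n : nat) (p : {mpoly K[n]}) :
  exists r : interp K SPoly, decode n r = p.
Proof.
exists [seq ([seq m i | i <- enum 'I_n], p@_m) | m : 'X_{1..n} <- msupp p].
rewrite /decode big_map [RHS]mpolyE; apply: eq_bigr => m _ /=.
congr (_ *: 'X_[_]); apply/mnmP => i.
by rewrite mnmE (nth_map i) ?size_enum_ord // nth_ord_enum.
Qed.

(* n, R_{=0} and R_{<>0}. *)
Definition SInput : sort := SProd SNat (SProd (SList SPoly) (SList SPoly)).

(* [None] is the negative answer; [Some (s, aps)] is the positive one, with the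
   list s of the factors of m and the list aps of the pairs (a_i, p_i). *)
Definition SOutput : sort :=
  SOpt (SProd (SList SPoly) (SList (SProd SPoly SPoly))).

(* Main.v *)
Require Import Defs.
From HB Require Import structures.
From mathcomp Require Import all_boot all_algebra.
From mathcomp Require Import finmap.
From mathcomp Require monalg.
From mathcomp Require Import mpoly.
From mathcomp Require Import perm ssrcomplements zify ring.
From Stdlib Require Import Classical.

Set Implicit Arguments.
Unset Strict Implicit.
Unset Printing Implicit Defensive.

Import GRing.Theory.
Local Open Scope ring_scope.

(** Write p_1, .., p_k for R0 and q for the product of Rn0.  The presentation
    collapses if and only if some power of q lies in the ideal generated by the
    p_i, and if this happens it happens with an exponent and with multipliers
    whose degrees are bounded by a computable function of the input.  The
    algorithm therefore computes such a bound and solves one linear system over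
    K: either a solution is the required identity, or there is no collapse.

    An identity gives a collapse (certificate_collapses): the elements known to
    vanish as a consequence of the presentation form an ideal, modulo which the
    lifting of polynomials from K[x] is a ring morphism; hence the product of
    the factors, which is known to be nonzero, is also known to be zero.

    For the converse, suppose that no power of q is in the ideal.  Then, by
    Rabinowitsch's trick, the p_i and 1 - t q generate a proper ideal I in
    K[x, t].  A collapse is incompatible with any proper ideal in a commutative
    ring modulo which the relations hold, being nonzero read as being invertible
    (model_not_collapses): going up a branch, one enlarges the ideal to decide
    whether an element is zero, and adjoins a variable y modulo f(y) to give a
    root to f.  No field has to be constructed.

    The degree bound (unit_combination_bounded) concerns families generating the
    unit ideal, and goes by induction on the number of variables.  After Nagata's
    change of variables one member of the family becomes monic in the variable x
    to be eliminated, so that every polynomial of small degree in x is a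
    combination of the family with multipliers of small degree in x.  This says
    that a Sylvester-like matrix over the remaining variables has a right
    inverse; so its maximal minors generate the unit ideal, by Cauchy-Binet, the
    induction hypothesis bounds a combination of the minors equal to 1, and the
    adjugates of the corresponding submatrices turn it into a combination of the
    given family.

    The linear system is solved by elimination, monomial after monomial, on
    polynomials that carry the list of their cofactors (t_solveP).  As one
    elimination step is a linear map, it preserves membership in a span; when
    all the monomials have been treated the products of the generators by
    monomials are reduced to 0, and the target is in their span if and only if
    it is reduced to 0 as well. *)

(** * Evaluation of integer polynomials *)

Module ZpolyTheory.
Import monalg.

Section Zeval.
Variables (G : choiceType) (A : comNzRingType) (nu : G -> A).

Let monval (m : {cmonom G}) : A := \prod_(g <- finsupp m) nu g ^+ m g.

Lemma monval_widen (d : {fset G}) (m : {cmonom G}) :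
  (finsupp m `<=` d)%fset -> monval m = \prod_(g <- d) nu g ^+ m g.
Proof.
move=> le; rewrite [LHS](big_fset_incl _ le) => //= x _.
by rewrite -cmE_eq0 => /eqP ->; rewrite expr0.
Qed.

Lemma monval_is_multiplicative : mmorphism monval.
Proof.
split=> [x y|]; last by rewrite /monval mdom1 big_seq_fset0.
have le1 : (finsupp x `<=` finsupp (mmul x y))%fset by rewrite mdomD fsubsetUl.
have le2 : (finsupp y `<=` finsupp (mmul x y))%fset by rewrite mdomD fsubsetUr.
rewrite (monval_widen le1) (monval_widen le2) -big_split /=.
by apply: eq_bigr => g _; rewrite cmM exprD.
Qed.

HB.instance Definition _ :=
  isMultiplicative.Build {cmonom G} A monval monval_is_multiplicative.

Let intval : {rmorphism int -> A} := @intmul A 1.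

Lemma zeval_is_additive : additive (zeval nu).
Proof. exact: (@mmap_is_additive {cmonom G} int A intval monval). Qed.

Lemma zeval_is_monoid_morphism : monoid_morphism (zeval nu).
Proof.
change (zeval nu) with (mmap intval monval : ZZ[G] -> A).
split; first exact: (rmorph1 (mmap intval monval)).
by move=> x y; exact: (rmorphM (mmap intval monval) x y).
Qed.

HB.instance Definition _ :=
  GRing.isAdditive.Build ZZ[G] A (zeval nu) zeval_is_additive.
HB.instance Definition _ :=
  GRing.isMonoidMorphism.Build ZZ[G] A (zeval nu) zeval_is_monoid_morphism.

Lemma zevalX g : zeval nu (Zvar g) = nu g.
Proof.
rewrite /zeval (@mmapU {cmonom G} int A intval monval) /intval mul1r.
by rewrite /monval mdomU big_seq_fset1 cmU eqxx expr1.
Qed.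

End Zeval.

Lemma zpoly_ind (G : choiceType) (P : ZZ[G] -> Prop) :
    P 1 -> (forall g, P (Zvar g)) -> (forall p q, P p -> P q -> P (p + q)) ->
    (forall p q, P p -> P q -> P (p * q)) -> (forall p, P p -> P (- p)) ->
  forall p, P p.
Proof.
move=> P1 PX PD PM PN p.
have P0 : P 0 by rewrite -(subrr 1); apply: PD => //; apply: PN.
have Pc (c : int) : P (c%:~R : ZZ[G]).
  have Pn n : P (n%:R : ZZ[G]).
    by elim: n => [//|n IH]; rewrite -addn1 natrD; apply: PD.
  by case: c => n; [apply: Pn | rewrite NegzE mulrNz; apply: PN; apply: Pn].
have Pm (m : {cmonom G}) : P (<< m >> : {malg int[{cmonom G}]}).
  have [n] := ubnP (@monalg.mdeg G m); elim: n m => [m lt0|n IH m le_m].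
    by exfalso; rewrite ltn0 in lt0.
  have [->|m1] := eqVneq m mone; first exact: P1.
  have [i mi] : exists i, (0 < m i)%N.
    apply: NNPP => none; case/eqP: m1; apply/eqP/cmP => i.
    rewrite cm1; case: (posnP (m i)) => [//|mi].
    by case: none; exists i.
  have mE : m = mmul (ucm i) (divcm m (ucm i)).
    apply/eqP/cmP => j; rewrite cmM divcmE cmU.
    by case: eqP => [<-|_]; rewrite /= ?subn0 ?subnKC.
  have -> : << m >> =
      (<< ucm i >> * << divcm m (ucm i) >> : {malg int[{cmonom G}]}).
    by rewrite malgM_def fgmulUU mulr1 -mE.
  apply: PM; first exact: PX.
  apply: IH; move: le_m; rewrite ltnS; apply: leq_trans.
  by rewrite [in leqRHS]mE mdegM mdegU.
have := monalgE (p : {malg int[{cmonom G}]}) => ->.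
apply: (big_ind P) => [|x y Px Py|m _]; [exact: P0 | exact: PD |].
have -> (c : int) : << c *g m >> = c%:~R * << m >> :> {malg int[{cmonom G}]}.
  by rewrite mulrzl -(raddfMz (mkmalgU m)) intz.
by apply: PM; [exact: Pc | exact: Pm].
Qed.

End ZpolyTheory.
Import ZpolyTheory.

Section ZevalTheory.
Variables (G : choiceType) (A : comNzRingType) (nu : G -> A).
Implicit Types p q : ZZ[G].

Lemma zeval0 : zeval nu 0 = 0. Proof. exact: rmorph0. Qed.
Lemma zeval1 : zeval nu 1 = 1. Proof. exact: rmorph1. Qed.
Lemma zevalD p q : zeval nu (p + q) = zeval nu p + zeval nu q.
Proof. exact: rmorphD. Qed.
Lemma zevalM p q : zeval nu (p * q) = zeval nu p * zeval nu q.
Proof. exact: rmorphM. Qed.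
Lemma zevalN p : zeval nu (- p) = - zeval nu p.
Proof. exact: rmorphN. Qed.
Lemma zeval_exp p k : zeval nu (p ^+ k) = zeval nu p ^+ k.
Proof. exact: rmorphXn. Qed.
Lemma zeval_sum (J : Type) (r : seq J) (P : pred J) (F : J -> ZZ[G]) :
  zeval nu (\sum_(j <- r | P j) F j) = \sum_(j <- r | P j) zeval nu (F j).
Proof. exact: rmorph_sum. Qed.
Lemma zeval_prod (J : Type) (r : seq J) (P : pred J) (F : J -> ZZ[G]) :
  zeval nu (\prod_(j <- r | P j) F j) = \prod_(j <- r | P j) zeval nu (F j).
Proof. exact: rmorph_prod. Qed.

End ZevalTheory.

(* From here on, integer polynomials are known only through their evaluation
   and their induction principle. *)
Opaque zeval Zvar Zpoly.

Lemma zeval_unique (G : choiceType) (A : comNzRingType) (nu : G -> A)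
    (h : ZZ[G] -> A) :
    h 1 = 1 -> (forall g, h (Zvar g) = nu g) -> {morph h : p q / p + q} ->
    {morph h : p q / p * q} -> {morph h : p / - p} ->
  h =1 zeval nu.
Proof.
move=> h1 hX hD hM hN p; elim/zpoly_ind: p => [|g|p q Hp Hq|p q Hp Hq|p Hp].
- by rewrite h1 zeval1.
- by rewrite hX zevalX.
- by rewrite hD zevalD Hp Hq.
- by rewrite hM zevalM Hp Hq.
- by rewrite hN zevalN Hp.
Qed.

Lemma zeval_rename (G H : choiceType) (A : comNzRingType) (f : G -> H)
    (nu : H -> A) (p : ZZ[G]) :
  zeval nu (zrename f p) = zeval (fun g => nu (f g)) p.
Proof.
apply: (zeval_unique (h := fun p => zeval nu (zrename f p))) => [|g|x y|x y|x].
- by rewrite /zrename !zeval1.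
- by rewrite /zrename !zevalX.
- by rewrite /zrename !zevalD.
- by rewrite /zrename !zevalM.
- by rewrite /zrename !zevalN.
Qed.

Lemma zeval_morph (G : choiceType) (A B : comNzRingType) (h : {rmorphism A -> B})
    (nu : G -> A) (p : ZZ[G]) : h (zeval nu p) = zeval (fun g => h (nu g)) p.
Proof.
apply: (zeval_unique (h := fun p => h (zeval nu p))) => [|g|x y|x y|x].
- by rewrite zeval1 rmorph1.
- by rewrite zevalX.
- by rewrite zevalD rmorphD.
- by rewrite zevalM rmorphM.
- by rewrite zevalN rmorphN.
Qed.

Lemma zeval_teval (X : Type) (G : choiceType) (A : comNzRingType) (nu : G -> A)
    (v : X -> ZZ[G]) (t : term X) :
  zeval nu (teval v t) = teval (fun x => zeval nu (v x)) t.
Proof.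
elim: t => [x||||s Hs t Ht|s Hs t Ht] /=.
- by [].
- exact: zeval0.
- exact: zeval1.
- by rewrite zevalN zeval1.
- by rewrite zevalD Hs Ht.
- by rewrite zevalM Hs Ht.
Qed.

Lemma teval_ext (X : Type) (A : nzRingType) (nu nu' : X -> A) :
  nu =1 nu' -> teval nu =1 teval nu'.
Proof. by move=> E; elim=> [x||||s Hs t Ht|s Hs t Ht] //=; rewrite Hs Ht. Qed.

(** * A collapsing presentation has no model *)

Record is_ideal (A : comNzRingType) (I : A -> Prop) : Prop := IsIdeal {
  ideal_zero : I 0;
  ideal_add : forall x y, I x -> I y -> I (x + y);
  ideal_mul : forall a x, I x -> I (a * x)
}.

Section IdealTheory.
Variables (A : comNzRingType) (I : A -> Prop) (I_ideal : is_ideal I).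

Lemma ideal_opp x : I x -> I (- x).
Proof. by rewrite -mulN1r; apply: ideal_mul. Qed.

Lemma ideal_sub x y : I x -> I y -> I (x - y).
Proof. by move=> Ix Iy; apply: ideal_add => //; apply: ideal_opp. Qed.

Lemma ideal_mulr a x : I x -> I (x * a).
Proof. by rewrite mulrC; apply: ideal_mul. Qed.

Lemma ideal_bigsum (J : Type) (r : seq J) (P : pred J) (F : J -> A) :
  (forall j, P j -> I (F j)) -> I (\sum_(j <- r | P j) F j).
Proof.
by move=> IF; apply: big_ind => //; [apply: ideal_zero | apply: ideal_add].
Qed.

End IdealTheory.

(** Truth of an atom in the quotient of A by I, where the symbol of being
    nonzero is read as invertibility: this makes sense in any ring, and spares
    the construction of fields. *)
Definition holds (A : comNzRingType) (I : A -> Prop) (a : atom A) : Prop :=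
  match a with Eq0 x => I x | Neq0 x => exists u, I (x * u - 1) end.

Definition models (A : comNzRingType) (I : A -> Prop) (G : choiceType)
    (nu : G -> A) (P : presentation G) : Prop :=
  forall a, P a -> holds I (amap (zeval nu) a).

Lemma amap_comp (R S T : Type) (f : S -> T) (g : R -> S) (h : R -> T) a :
  (forall x, f (g x) = h x) -> amap f (amap g a) = amap h a.
Proof. by move=> fg; case: a => x /=; rewrite fg. Qed.

Section AlgebraicAxioms.
Variables (A : comNzRingType) (I : A -> Prop) (I_ideal : is_ideal I).

Definition join_vals (k : nat) (t : nat -> A) (y : 'I_k -> A)
    (v : nat + 'I_k) : A :=
  match v with inl i => t i | inr j => y j end.

(** The algebraic axioms are those whose conclusion introduces no new element:
    they hold in A itself, so that models are closed under consequences. *)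
Lemma holds_algebraic_axiom ax D (t : nat -> A) (y : 'I_(d_num D) -> A) :
    ACF ax -> ax_concl ax = [:: D] -> d_num D = 0%N ->
    (forall h, List.In h (ax_hyps ax) -> holds I (amap (teval t) h)) ->
  forall b, List.In b (d_body D) -> holds I (amap (teval (join_vals t y)) b).
Proof.
case=> [|||||||||| n n_gt0] //= [ED]; subst D => //= _ tH b [<-|//] /=.
- exact: ideal_zero.
- apply: (ideal_add I_ideal); first by apply: (tH (Eq0 hX)); left.
  by apply: (tH (Eq0 hY)); right; left.
- by apply: (ideal_mulr I_ideal); apply: (tH (Eq0 hX)); left.
- have Ix : I (t 0%N) by apply: (tH (Eq0 hX)); left.
  have [u Iu] : exists u, I (t 1%N * u - 1) by apply: (tH (Neq0 hY)); right; left.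
  exists u; rewrite mulrDl -addrA; apply: (ideal_add I_ideal) => //.
  exact: (ideal_mulr I_ideal).
- have [u Iu] : exists u, I (t 0%N * u - 1) by apply: (tH (Neq0 hX)); left.
  have [v Iv] : exists v, I (t 1%N * v - 1) by apply: (tH (Neq0 hY)); right; left.
  exists (u * v).
  have -> : t 0%N * t 1%N * (u * v) - 1 =
      t 1%N * v * (t 0%N * u - 1) + (t 1%N * v - 1) by ring.
  by apply: (ideal_add I_ideal) => //; apply: (ideal_mul I_ideal).
- by exists 1; rewrite mulr1 subrr; apply: ideal_zero.
- exists (t 1%N).
  exact: (tH (Eq0 (TAdd (TMul hX hY) TMinusOne)) (or_introl erefl)).
Qed.

Lemma consequence_holds (G : choiceType) (nu : G -> A) (P : presentation G) a :
  models I nu P -> consequence ACF P a -> holds I (amap (zeval nu) a).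
Proof.
move=> nuP; elim=> [{}a /nuP //|ax b t axP axE _ IH].
set v := fun x : nat + 'I_0 => match x with inl i => t i | inr _ => 0 end.
have -> : amap (zeval nu) (single_inst t b) =
    amap (teval (join_vals (fun i => zeval nu (t i)) (fun j => 0))) b.
  apply: amap_comp => s; rewrite zeval_teval; apply: teval_ext.
  by case=> //= i; rewrite zeval0.
apply: (@holds_algebraic_axiom ax (single b)) => //; last by left.
move=> h /IH; rewrite /hyp_inst (amap_comp (h := teval (fun i => zeval nu (t i)))) //.
by move=> s; rewrite zeval_teval.
Qed.

End AlgebraicAxioms.

Lemma enrich_models (A : comNzRingType) (I : A -> Prop) (G : choiceType)
    (nu : G -> A) (P : presentation G) l :
  is_ideal I -> models I nu P -> consequences ACF P l ->
  models I nu (enrich P l).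
Proof. by move=> ? nuP lP a [/nuP|/lP /consequence_holds]//; apply. Qed.

Section MonicRoot.
Variables (A : comNzRingType) (I : A -> Prop) (I_ideal : is_ideal I).
Variables (f : {poly A}).

(** The ideal of A[y] generated by I and f. *)
Definition ext_ideal (z : {poly A}) : Prop :=
  exists u q : {poly A}, (forall i, I u`_i) /\ z = u + q * f.

Lemma ext_ideal_is_ideal : is_ideal ext_ideal.
Proof.
split.
- by exists 0, 0; split=> [i|]; rewrite ?coef0 ?mul0r ?addr0 //; apply: ideal_zero.
- move=> _ _ [u [q [Iu ->]]] [v [r [Iv ->]]]; exists (u + v), (q + r).
  split=> [i|]; first by rewrite coefD; apply: ideal_add.
  by ring.
- move=> a _ [u [q [Iu ->]]]; exists (a * u), (a * q).
  split=> [i|]; last by ring.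
  by rewrite coefM; apply: ideal_bigsum => // j _; apply: ideal_mul.
Qed.

(** Over A/I, the quotient by the monic polynomial f is free with 1 in a basis,
    so it does not vanish unless A/I does.  Directly: if 1 = u + q f then the
    coefficients of q lie in I, from the leading one downwards. *)
Lemma ext_ideal_proper : f \is monic -> (1 < size f)%N -> ~ I 1 -> ~ ext_ideal 1.
Proof.
move=> f_monic f_big I1 [u [q [Iu E]]]; set n := (size f).-1.
have n_gt0 : (0 < n)%N by rewrite /n; case: (size f) f_big => [|[]].
have fn : f`_n = 1 by move: f_monic; rewrite monicE lead_coefE => /eqP.
have Iq k : forall j, (size q <= j + k)%N -> I q`_j.
  elim: k => [|k IH] j le_j.
    by rewrite nth_default; [apply: ideal_zero | rewrite addn0 in le_j].
  have := congr1 (fun p : {poly A} => p`_(j + n)) E.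
  rewrite coefD coef1 addn_eq0 [n == 0%N]eqn0Ngt n_gt0 andbF mulr0n coefM.
  rewrite (bigD1 (inord j)) //= inordK ?ltnS ?leq_addr // addKn fn mulr1.
  move=> E0; have -> : q`_j = - u`_(j + n)
      - \sum_(i < (j + n).+1 | i != inord j) q`_i * f`_(j + n - i).
    move: E0; move: (u`__) (q`_j) (\sum_(_ <- _ | _) _) => a b c E0.
    by rewrite -[- a]add0r E0; ring.
  apply: ideal_sub => //; first exact: ideal_opp.
  apply: ideal_bigsum => // i ne_ij.
  have [le_ji|lt_ij] := leqP j.+1 i.
    apply: ideal_mulr => //; apply: IH; apply: leq_trans le_j _.
    by rewrite addnS -addSn leq_add2r.
  have lt_i : (i < j)%N.
    rewrite ltn_neqAle -ltnS lt_ij andbT.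
    apply: contraNneq ne_ij => E'; apply/eqP/val_inj.
    by rewrite /= inordK ?ltnS ?leq_addr.
  rewrite [f`__]nth_default ?mulr0; first exact: ideal_zero.
  rewrite -[size f]prednK ?(ltnW f_big) // -/n ltn_subRL ltn_add2r; exact: lt_i.
apply: I1; rewrite -[1](coef1 A 0) E coefD coefM; apply: ideal_add => //.
apply: ideal_bigsum => // i _; apply: ideal_mulr => //.
by apply: (Iq (size q)); rewrite leq_addl.
Qed.

End MonicRoot.

Definition satisfies (A : comNzRingType) (I : A -> Prop) (t : nat -> A)
    (D : disjunct) : Prop :=
  exists y : 'I_(d_num D) -> A,
    forall b, List.In b (d_body D) -> holds I (amap (teval (join_vals t y)) b).

(** The only axioms that force the model to change are the case distinction on
    x, for which I is enlarged by x unless x is invertible modulo I, and the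
    existence of a root of a monic polynomial f, adjoined as y in A[y].  An
    inverse of a nonzero element is already there, by definition of [holds]. *)
Lemma axiom_extends_model (A : comNzRingType) (I : A -> Prop) ax (t : nat -> A) :
    is_ideal I -> ~ I 1 -> ACF ax ->
    (forall h, List.In h (ax_hyps ax) -> holds I (amap (teval t) h)) ->
  exists (B : comNzRingType) (J : B -> Prop) (h : {rmorphism A -> B}),
    [/\ is_ideal J, ~ J 1, forall x, I x -> J (h x) &
      exists2 D, List.In D (ax_concl ax) & satisfies J (fun i => h (t i)) D].
Proof.
move=> I_ideal I1 axP tH.
have algebraic D : ax_concl ax = [:: D] -> d_num D = 0%N ->
  exists (B : comNzRingType) (J : B -> Prop) (h : {rmorphism A -> B}),
    [/\ is_ideal J, ~ J 1, forall x, I x -> J (h x) &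
      exists2 D, List.In D (ax_concl ax) & satisfies J (fun i => h (t i)) D].
  move=> ED D0; exists A, I, idfun; split=> //; exists D; first by rewrite ED; left.
  by exists (fun=> 0) => b; apply: holds_algebraic_axiom ED D0 _ _.
case: axP tH algebraic; try by move=> _ /(_ _ erefl erefl).
- move=> tH _; have [|u] := tH (Neq0 TZero); first by left.
  rewrite /= mul0r sub0r => /(ideal_opp I_ideal); rewrite opprK => I1'.
  by case: (I1 I1').
- move=> tH _; have [|u Iu] := tH (Neq0 hX); first by left.
  exists A, I, idfun; split=> //; eexists; first by left.
  by exists (fun=> u) => b [<-|//].
- move=> _ _; set x := t 0%N.
  have [[u Iu]|noinv] := classic (exists u, I (x * u - 1)).
    exists A, I, idfun; split=> //.
    exists (single (Neq0 (cX 0))); first by right; left.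
    by exists (fun=> 0) => b [<-|//]; exists u.
  exists A, (fun z => exists a, I (z - a * x)), idfun; split.
  + split.
    * by exists 0; rewrite mul0r subr0; apply: ideal_zero.
    * move=> y z [a Ia] [b Ib]; exists (a + b).
      have -> : y + z - (a + b) * x = (y - a * x) + (z - b * x) by ring.
      exact: ideal_add.
    * move=> c y [a Ia]; exists (c * a).
      have -> : c * y - c * a * x = c * (y - a * x) by ring.
      exact: ideal_mul.
  + case=> a Ia; apply: noinv; exists a.
    by rewrite -opprB mulrC; apply: ideal_opp.
  + by move=> y Iy; exists 0; rewrite mul0r subr0.
  + exists (single (Eq0 (cX 0))); first by left.
    exists (fun=> 0) => b [<-|//]; exists 1.
    by rewrite /= mul1r subrr; apply: ideal_zero.
- move=> n n_gt0 _ _.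
  pose p : {poly A} := \sum_(i < n) t i *: 'X^i.
  have size_p : (size p < size ('X^n : {poly A}))%N.
    rewrite size_polyXn ltnS; apply: (leq_trans (size_sum _ _ _)).
    apply/bigmax_leqP => i _; apply: leq_trans (size_scale_leq _ _) _.
    by rewrite size_polyXn.
  exists {poly A}, (ext_ideal I ('X^n + p)), polyC; split.
  + exact: ext_ideal_is_ideal.
  + apply: ext_ideal_proper => //; last by rewrite size_polyDl // size_polyXn.
    by rewrite monicE lead_coefDl // lead_coefXn.
  + move=> x Ix; exists x%:P, 0; rewrite mul0r addr0; split=> // i.
    by rewrite coefC; case: eqP => // _; apply: ideal_zero.
  + exists (@Disjunct 1 [:: Eq0 (monic_term n)]);
      first by left.
    exists (fun=> 'X) => b [<-|//] /=; set v := join_vals _ _.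
    have -> : teval v (monic_term n) = 'X^n + p.
      have pow k : teval v (tpow cY k) = 'X^k.
        by elim: k => [|k IH] //=; rewrite IH -exprS.
      rewrite /monic_term /p -(big_mkord xpredT (fun i => t i *: 'X^i)).
      rewrite /index_iota subn0; elim: (iota 0 n) => [|i s IH].
        by rewrite /= pow big_nil addr0.
      rewrite /= IH big_cons pow -addrA; congr (_ + _).
      by rewrite addrC mul_polyC.
    by exists 0, 1; rewrite mul1r add0r; split=> // i; rewrite coef0; apply: ideal_zero.
Qed.

(** At a dead end the axiom with an empty conclusion would turn a model into a
    model of one of no disjuncts; induction propagates this to the root. *)
Fixpoint dead_tree_no_model (G : choiceType) (P : presentation G)
    (c : ctree ACF P) {struct c} :
    all_dead c -> forall (A : comNzRingType) (I : A -> Prop) (nu : G -> A),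
    is_ideal I -> ~ I 1 -> ~ models I nu P
with dead_forest_no_model (G : choiceType) (P : presentation G)
    (t : nat -> ZZ[G]) (Ds : seq disjunct) (f : cforest ACF P t Ds) {struct f} :
    all_dead_forest f -> forall (A : comNzRingType) (I : A -> Prop) (nu : G -> A),
    is_ideal I -> ~ I 1 -> models I nu P ->
    forall D, List.In D Ds -> ~ satisfies I (fun i => zeval nu (t i)) D.
Proof.
- case: c => [//|ax t axP tP f] /= f_dead A I nu I_ideal I1 nuP.
  have [|B [J [h [J_ideal J1 hI [D DP [y yP]]]]]] :=
      @axiom_extends_model A I ax (fun i => zeval nu (t i)) I_ideal I1 axP.
    move=> a /tP /nuP; rewrite /hyp_inst.
    rewrite (amap_comp (h := teval (fun i => zeval nu (t i)))) //.
    by move=> s; rewrite zeval_teval.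
  apply: (dead_forest_no_model _ _ _ _ f f_dead B J (fun g => h (nu g))
            J_ideal J1 _ D DP).
    move=> a /nuP; case: a => z /=; rewrite -zeval_morph; first exact: hI.
    by case=> u /hI; rewrite rmorphB rmorph1 rmorphM => Ju; exists (h u).
  exists y => b /yP; rewrite -(@amap_comp _ _ _ id _ _ _ (fun x => erefl)).
  pose t' i := zeval (fun g => h (nu g)) (t i).
  case: b => z /=; rewrite (@teval_ext _ _ _ (join_vals t' y)) //;
    by case=> //= i; rewrite zeval_morph.
- case: f => [//|{}t D Ds' l lP c f] /= /andP[c_dead f_dead] A I nu I_ideal I1 nuP D'.
  case=> [ED|D'P]; last exact: (dead_forest_no_model _ _ _ _ f f_dead).
  subst D' => -[y yP].
  pose mu (g : G + 'I_(d_num D)) := match g with inl g => nu g | inr j => y j end.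
  apply: (dead_tree_no_model _ _ c c_dead A I mu I_ideal I1).
  apply: enrich_models => // a [[b /nuP bP ->]|].
    by rewrite (amap_comp (h := zeval nu)) // => x; rewrite zeval_rename.
  case/List.in_map_iff=> b [<- /yP].
  rewrite /disj_inst.
  rewrite (amap_comp (h := teval (join_vals (fun i => zeval nu (t i)) y))) //.
  move=> s; rewrite zeval_teval; apply: teval_ext; case=> [i|j] /=.
    by rewrite zeval_rename.
  by rewrite zevalX.
Qed.

Theorem model_not_collapses (G : choiceType) (P : presentation G)
    (A : comNzRingType) (I : A -> Prop) (nu : G -> A) :
  is_ideal I -> ~ I 1 -> models I nu P -> ~ collapses ACF P.
Proof.
move=> I_ideal I1 nuP [[l lP c] /= c_dead].
exact: (dead_tree_no_model c_dead I_ideal I1 (enrich_models I_ideal nuP lP)).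
Qed.

(** * An algebraic identity yields a collapse *)

Lemma List_In_mem (T : eqType) (x : T) s : List.In x s -> x \in s.
Proof.
by elim: s => //= y s IH [->|/IH xs]; rewrite inE ?eqxx ?xs ?orbT.
Qed.

Section Consequences.
Variables (G : choiceType) (P : presentation G).

Definition zero_rel (p : ZZ[G]) : Prop := consequence ACF P (Eq0 p).
Definition nonzero_rel (p : ZZ[G]) : Prop := consequence ACF P (Neq0 p).

Let subst2 (p q : ZZ[G]) (i : nat) : ZZ[G] := if i is 0%N then p else q.

Lemma algebraic_axiom_consequence hyps b (t : nat -> ZZ[G]) a :
    ACF (DAxiom hyps [:: single b]) -> a = single_inst t b ->
    (forall h, List.In h hyps -> consequence ACF P (hyp_inst t h)) ->
  consequence ACF P a.
Proof.
move=> axP -> tP.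
exact: (consequence_ax (ax := DAxiom hyps [:: single b]) axP erefl tP).
Qed.

Lemma zero_rel_ideal : is_ideal zero_rel.
Proof.
split=> [|p q Zp Zq|q p Zp].
- by apply: (algebraic_axiom_consequence (t := fun=> 0) ACF_zero).
- apply: (algebraic_axiom_consequence (t := subst2 p q) ACF_add) => //.
  by move=> h [<-|[<-|//]].
- rewrite mulrC; apply: (algebraic_axiom_consequence (t := subst2 p q) ACF_mul) => //.
  by move=> h [<-|//].
Qed.

Lemma nonzero_rel1 : nonzero_rel 1.
Proof. by apply: (algebraic_axiom_consequence (t := fun=> 0) ACF_one). Qed.

Lemma nonzero_relM p q : nonzero_rel p -> nonzero_rel q -> nonzero_rel (p * q).
Proof.
move=> Np Nq; apply: (algebraic_axiom_consequence (t := subst2 p q) ACF_mul_neq) => //.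
by move=> h [<-|[<-|//]].
Qed.

Lemma nonzero_relD p q : zero_rel p -> nonzero_rel q -> nonzero_rel (p + q).
Proof.
move=> Zp Nq; apply: (algebraic_axiom_consequence (t := subst2 p q) ACF_add_neq) => //.
by move=> h [<-|[<-|//]].
Qed.

Lemma nonzero_rel_prod (J : Type) (r : seq J) (F : J -> ZZ[G]) :
  (forall j, List.In j r -> nonzero_rel (F j)) -> nonzero_rel (\prod_(j <- r) F j).
Proof.
elim: r => [|j r IH] NF; first by rewrite big_nil; apply: nonzero_rel1.
rewrite big_cons; apply: nonzero_relM; first by apply: NF; left.
by apply: IH => i ri; apply: NF; right.
Qed.

Lemma collapses_of_zero_nonzero p : zero_rel p -> nonzero_rel p -> collapses ACF P.
Proof.
move=> Zp Np; have N0 : nonzero_rel 0.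
  by rewrite -(addNr p); apply: nonzero_relD => //; apply: ideal_opp zero_rel_ideal _ _.
have lP : consequences ACF P [:: Neq0 0] by move=> a [<-|//].
have hP h : List.In h [:: Neq0 TZero] ->
    enrich P [:: Neq0 0] (hyp_inst (fun=> 0) h) by case=> [<-|//]; right; left.
by exists (Covering lP (@CNode _ _ _ (DAxiom [:: Neq0 TZero] [::]) _ ACF_bot hP
  (CNil _ _ _))).
Qed.

End Consequences.

Section LiftMorphism.
Variables (K : fieldType) (n : nat) (P : presentation (K + 'I_n)%type).
Hypothesis P_diagram : forall b, @diagram K b -> P (amap (zrename inl) b).

Let Z := zero_rel P.
Let Z_ideal : is_ideal Z := zero_rel_ideal P.
Let C (c : K) : ZZ[(K + 'I_n)%type] := Zvar (inl c).
Let M (m : 'X_{1..n}) : ZZ[(K + 'I_n)%type] := mmap1 (fun i => Zvar (inr i)) m.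

Lemma diagram_zero (z : ZZ[K]) : zeval id z = 0 -> Z (zrename inl z).
Proof. by move=> z0; apply: consequence_rel; apply: (P_diagram (b := Eq0 z)). Qed.

Let C0 : Z (C 0).
Proof.
have := @diagram_zero (Zvar 0); rewrite /zrename !zevalX; exact.
Qed.

Let C1 : Z (C 1 - 1).
Proof.
have evalE (A : comNzRingType) (nu : K -> A) :
    zeval nu (Zvar 1 - 1) = nu 1 - 1.
  by rewrite zevalD zevalN; congr (_ - _); [apply: zevalX | apply: zeval1].
have := @diagram_zero (Zvar 1 - 1).
by rewrite /zrename !evalE; apply; rewrite subrr.
Qed.

Let CD a b : Z (C (a + b) - (C a + C b)).
Proof.
have evalE (A : comNzRingType) (nu : K -> A) :
    zeval nu (Zvar (a + b) - (Zvar a + Zvar b)) = nu (a + b) - (nu a + nu b).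
  by rewrite zevalD zevalN zevalD; congr (_ - (_ + _)); apply: zevalX.
have := @diagram_zero (Zvar (a + b) - (Zvar a + Zvar b)).
by rewrite /zrename !evalE; apply; rewrite subrr.
Qed.

Let CM a b : Z (C (a * b) - C a * C b).
Proof.
have evalE (A : comNzRingType) (nu : K -> A) :
    zeval nu (Zvar (a * b) - Zvar a * Zvar b) = nu (a * b) - nu a * nu b.
  by rewrite zevalD zevalN zevalM; congr (_ - _ * _); apply: zevalX.
have := @diagram_zero (Zvar (a * b) - Zvar a * Zvar b).
by rewrite /zrename !evalE; apply; rewrite subrr.
Qed.

(** The lifting is not a ring morphism, the generators X_(a + b), X_a and X_b
    being independent; it is one up to this congruence, because the diagram
    contains all the relations between the X_a. *)
Definition congr_rel (x y : ZZ[(K + 'I_n)%type]) : Prop := Z (x - y).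
Local Notation "x ~~ y" := (congr_rel x y) (at level 70).

Lemma congr_refl x : x ~~ x.
Proof. by rewrite /congr_rel subrr; apply: ideal_zero Z_ideal. Qed.

Lemma congr_sym x y : x ~~ y -> y ~~ x.
Proof. by move=> xy; rewrite /congr_rel -opprB; apply: ideal_opp Z_ideal _ xy. Qed.

Lemma congr_trans y x z : x ~~ y -> y ~~ z -> x ~~ z.
Proof.
by move=> xy yz; rewrite /congr_rel -(subrKA y); apply: (ideal_add Z_ideal).
Qed.

Lemma congrD x y x' y' : x ~~ x' -> y ~~ y' -> x + y ~~ x' + y'.
Proof.
move=> xx' yy'; rewrite /congr_rel opprD addrACA; exact: (ideal_add Z_ideal).
Qed.

Lemma congrM x y x' y' : x ~~ x' -> y ~~ y' -> x * y ~~ x' * y'.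
Proof.
move=> xx' yy'; rewrite /congr_rel.
have -> : x * y - x' * y' = y * (x - x') + x' * (y - y').
  by rewrite !mulrBr [y * x]mulrC [y * x']mulrC addrA subrK.
by apply: (ideal_add Z_ideal); apply: (ideal_mul Z_ideal).
Qed.

Lemma congr_sum (J : finType) (F F' : J -> ZZ[(K + 'I_n)%type]) :
  (forall j, F j ~~ F' j) -> \sum_j F j ~~ \sum_j F' j.
Proof.
move=> FF'; rewrite /congr_rel -sumrB; apply: (ideal_bigsum Z_ideal) => j _.
exact: FF'.
Qed.

(** Sums over a common set of monomials can be added termwise; the additional
    terms are not 0 but multiples of X_0, which is congruent to 0. *)
Lemma lift_poly_widen (p : {mpoly K[n]}) k : (msize p <= k)%N ->
  lift_poly p ~~ \sum_(m : 'X_{1..n < k}) C p@_m * M m.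
Proof.
move=> le_pk; set J : subFinType _ := 'X_{1..n < k}.
rewrite /lift_poly /mpoly.mmap (big_mksub J) ?msupp_uniq //=; first last.
  by move=> x /msize_mdeg_lt /leq_trans; apply.
rewrite [X in _ ~~ X](bigID (fun m : J => val m \in msupp p)) /=.
rewrite /congr_rel opprD addrA subrr sub0r; apply: (ideal_opp Z_ideal).
apply: (ideal_bigsum Z_ideal) => m /memN_msupp_eq0 ->.
exact: (ideal_mulr Z_ideal _ C0).
Qed.

Lemma lift_polyD p q : lift_poly (p + q) ~~ lift_poly p + lift_poly q.
Proof.
pose k := maxn (msize p) (msize q).
have le_p : (msize p <= k)%N by rewrite leq_maxl.
have le_q : (msize q <= k)%N by rewrite leq_maxr.
apply: (congr_trans (lift_poly_widen (msizeD_le p q))).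
apply: congr_sym.
apply: (congr_trans (congrD (lift_poly_widen le_p) (lift_poly_widen le_q))).
rewrite -big_split /=; apply: congr_sum => m; rewrite -mulrDl mcoeffD.
by apply: congrM; [apply: congr_sym; apply: CD | apply: congr_refl].
Qed.

Lemma lift_poly0 : lift_poly (0 : {mpoly K[n]}) = 0.
Proof. by rewrite /lift_poly /mpoly.mmap msupp0 big_nil. Qed.

Lemma lift_poly_monomial c m : lift_poly (c *: 'X_[m] : {mpoly K[n]}) ~~ C c * M m.
Proof.
have [->|nz_c] := eqVneq c 0.
  rewrite scale0r lift_poly0; apply: congr_sym; rewrite /congr_rel subr0.
  exact: (ideal_mulr Z_ideal _ C0).
rewrite /lift_poly /mpoly.mmap msuppMCX // big_seq1 mcoeffZ mcoeffX eqxx mulr1.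
exact: congr_refl.
Qed.

Lemma lift_polyM p q : lift_poly (p * q) ~~ lift_poly p * lift_poly q.
Proof.
have MM m m' : M (m + m') = M m * M m'.
  by rewrite /M /mmap1 -big_split; apply: eq_bigr => i _; rewrite mnmDE exprD.
have monom c m : lift_poly (c *: 'X_[m] * q) ~~ C c * M m * lift_poly q.
  elim/mpolyind: q => [|d m' q _ _ IH].
    by rewrite mulr0 lift_poly0 mulr0; apply: congr_refl.
  have monom2 : lift_poly (c *: 'X_[m] * (d *: 'X_[m'])) ~~
      C c * M m * lift_poly (d *: 'X_[m'] : {mpoly K[n]}).
    rewrite -scalerAl -scalerAr scalerA -mpolyXD.
    apply: (congr_trans (lift_poly_monomial _ _)); rewrite MM.
    apply: congr_sym.
    apply: (congr_trans (congrM (congr_refl _) (lift_poly_monomial _ _))).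
    rewrite [X in congr_rel X _]mulrACA.
    by apply: (congrM _ (congr_refl _)); apply: congr_sym; apply: CM.
  rewrite mulrDr; apply: (congr_trans (lift_polyD _ _)).
  apply: (congr_trans (congrD monom2 IH)); rewrite -[X in congr_rel X _]mulrDr.
  by apply: (congrM (congr_refl _)); apply: congr_sym; apply: lift_polyD.
elim/mpolyind: p => [|c m p _ _ IH].
  by rewrite mul0r lift_poly0 mul0r; apply: congr_refl.
rewrite mulrDl; apply: (congr_trans (lift_polyD _ _)).
apply: (congr_trans (congrD (monom c m) IH)); rewrite -mulrDl.
apply: (congrM _ (congr_refl _)); apply: congr_sym.
apply: (congr_trans (lift_polyD _ _)).
by apply: (congrD _ (congr_refl _)); apply: lift_poly_monomial.
Qed.

Lemma lift_poly1 : lift_poly (1 : {mpoly K[n]}) ~~ 1.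
Proof.
have := lift_poly_monomial 1 0; rewrite scale1r mpolyX0 /M mmap11 mulr1.
by move/congr_trans; apply; apply: C1.
Qed.

Lemma lift_poly_prod (J : Type) (r : seq J) (F : J -> {mpoly K[n]}) :
  lift_poly (\prod_(j <- r) F j) ~~ \prod_(j <- r) lift_poly (F j).
Proof.
elim: r => [|j r IH]; first by rewrite !big_nil; apply: lift_poly1.
rewrite !big_cons; apply: (congr_trans (lift_polyM _ _)).
exact: (congrM (congr_refl _) IH).
Qed.

Lemma lift_poly_sum (J : Type) (r : seq J) (F : J -> {mpoly K[n]}) :
  lift_poly (\sum_(j <- r) F j) ~~ \sum_(j <- r) lift_poly (F j).
Proof.
elim: r => [|j r IH]; first by rewrite !big_nil lift_poly0; apply: congr_refl.
rewrite !big_cons; apply: (congr_trans (lift_polyD _ _)).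
exact: (congrD (congr_refl _) IH).
Qed.

End LiftMorphism.

Theorem certificate_collapses (K : fieldType) (n : nat)
    (R0 Rn0 factors : seq {mpoly K[n]})
    (pairs : seq ({mpoly K[n]} * {mpoly K[n]})) :
    {subset factors <= Rn0} -> {subset unzip2 pairs <= R0} ->
    \prod_(q <- factors) q = \sum_(ap <- pairs) ap.1 * ap.2 ->
  collapses ACF (dg_presentation R0 Rn0).
Proof.
move=> sub_f sub_p E; set P := dg_presentation R0 Rn0.
have Pd b : @diagram K b -> P (amap (zrename inl) b) by move=> db; left; exists b.
have Z_ideal := zero_rel_ideal P.
apply: (@collapses_of_zero_nonzero _ _ (lift_poly (\sum_(ap <- pairs) ap.1 * ap.2))).
  have := ideal_add Z_ideal (lift_poly_sum Pd pairs (fun ap => ap.1 * ap.2)).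
  rewrite -/(zero_rel P) => /(_ (\sum_(ap <- pairs) lift_poly (ap.1 * ap.2))).
  rewrite subrK; apply.
  elim: pairs sub_p {E} => [|[a p] pairs IH] sub_p.
    by rewrite big_nil; apply: ideal_zero.
  rewrite big_cons; apply: ideal_add => //; last first.
    by apply: IH => x xp; apply: sub_p; rewrite inE xp orbT.
  have := ideal_add Z_ideal (lift_polyM Pd a p) (y := lift_poly a * lift_poly p).
  rewrite subrK; apply; apply: ideal_mul => //; apply: consequence_rel; right.
  by exists p => //; apply: sub_p; rewrite inE eqxx.
rewrite -E; have := nonzero_relD (lift_poly_prod Pd factors id).
move=> /(_ (\prod_(q <- factors) lift_poly q)); rewrite subrK; apply.
apply: nonzero_rel_prod => q qf; apply: consequence_rel; right.
by exists q => //; apply: sub_f; apply: List_In_mem.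
Qed.

(** * Degrees of polynomials *)

Section DegreeBounds.
Variables (K : fieldType) (n : nat).
Implicit Types (p q : {mpoly K[n]}) (d e : nat).

(** Unlike [msize], this has no exception at 0 and adds up in products. *)
Definition deg_le d p : bool := (msize p <= d.+1)%N.

Lemma deg_leW d e p : (d <= e)%N -> deg_le d p -> deg_le e p.
Proof. by move=> de pd; apply: leq_trans pd _. Qed.

Lemma deg_le_coef d p : (forall m, p@_m != 0 -> (mdeg m <= d)%N) -> deg_le d p.
Proof.
move=> pd; rewrite /deg_le msizeE big_seq; apply/bigmax_leqP_seq => m mp _.
by rewrite ltnS pd // -mcoeff_msupp.
Qed.

Lemma deg_leP d p m : deg_le d p -> p@_m != 0 -> (mdeg m <= d)%N.
Proof.
by rewrite -mcoeff_msupp -ltnS => pd /msize_mdeg_lt /leq_trans; apply.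
Qed.

Lemma deg_leC d c : deg_le d c%:MP.
Proof. by rewrite /deg_le msizeC; case: (c != 0). Qed.

Lemma deg_le0 d : deg_le d 0.
Proof. by rewrite -mpolyC0 deg_leC. Qed.

Lemma deg_le1 d : deg_le d 1.
Proof. by rewrite -mpolyC1 deg_leC. Qed.

Lemma deg_leX i : deg_le 1 ('X_i : {mpoly K[n]}).
Proof. by rewrite /deg_le msizeX mdeg1. Qed.

Lemma deg_leD d p q : deg_le d p -> deg_le d q -> deg_le d (p + q).
Proof.
move=> pd qd; apply: leq_trans (msizeD_le _ _) _.
by rewrite geq_max; apply/andP.
Qed.

Lemma deg_leN d p : deg_le d p -> deg_le d (- p).
Proof. by rewrite /deg_le msizeN. Qed.

Lemma deg_leM d e p q : deg_le d p -> deg_le e q -> deg_le (d + e) (p * q).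
Proof.
move=> pd qe; apply: deg_le_coef => m; rewrite -mcoeff_msupp => /msuppM_le.
case/allpairsP=> -[m1 m2] /= [m1p m2q ->]; rewrite mdegD.
by rewrite leq_add // (deg_leP pd, deg_leP qe) // -mcoeff_msupp.
Qed.

Lemma deg_le_sum (J : Type) (r : seq J) (P : pred J) (F : J -> {mpoly K[n]}) d :
  (forall j, P j -> deg_le d (F j)) -> deg_le d (\sum_(j <- r | P j) F j).
Proof.
move=> Fd; apply: (big_ind (fun p => deg_le d p)) => // [|p q].
  exact: deg_le0.
exact: deg_leD.
Qed.

Lemma deg_le_prod (J : Type) (r : seq J) (F : J -> {mpoly K[n]}) (d : J -> nat) :
  (forall j, deg_le (d j) (F j)) ->
  deg_le (\sum_(j <- r) d j) (\prod_(j <- r) F j).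
Proof.
move=> Fd; apply: (big_rec2 (fun e p => deg_le e p)) => [|j e p _].
  exact: deg_le1.
exact: deg_leM.
Qed.

Lemma deg_leXn d p k : deg_le d p -> deg_le (d * k) (p ^+ k).
Proof.
move=> pd; elim: k => [|k IH]; first exact: deg_le1.
by rewrite exprS mulnS; apply: deg_leM.
Qed.

Lemma deg_le_sign d (b : nat) : deg_le d ((-1) ^+ b : {mpoly K[n]}).
Proof. by rewrite -mpolyC1 -mpolyCN -rmorphXn; apply: deg_leC. Qed.

Lemma deg_le_det m (A : 'M[{mpoly K[n]}]_m) d :
  (forall i j, deg_le d (A i j)) -> deg_le (m * d) (\det A).
Proof.
move=> Ad; apply: deg_le_sum => s _; rewrite -[(m * d)%N]add0n.
apply: deg_leM; first exact: deg_le_sign.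
have := @deg_le_prod _ (index_enum 'I_m) (fun i => A i (s i)) (fun=> d).
by rewrite sum_nat_const card_ord; apply=> i.
Qed.

Lemma deg_le_adj m (A : 'M[{mpoly K[n]}]_m) d i j :
  (forall i j, deg_le d (A i j)) -> deg_le (m * d) ((\adj A) i j).
Proof.
move=> Ad; rewrite mxE /cofactor -[(m * d)%N]add0n.
apply: deg_leM; first exact: deg_le_sign.
apply: (@deg_leW (m.-1 * d)); first by rewrite leq_mul2r leq_pred orbT.
by apply: deg_le_det => k l; rewrite !mxE.
Qed.

Definition coef_deg_le d (p : {poly {mpoly K[n]}}) : Prop :=
  forall k, deg_le d p`_k.

Lemma coef_deg_leM d e (p q : {poly {mpoly K[n]}}) :
  coef_deg_le d p -> coef_deg_le e q -> coef_deg_le (d + e) (p * q).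
Proof.
by move=> pd qe k; rewrite coefM; apply: deg_le_sum => i _; apply: deg_leM.
Qed.

Lemma coef_deg_le_sum (J : Type) (r : seq J) (P : pred J)
    (F : J -> {poly {mpoly K[n]}}) d :
  (forall j, P j -> coef_deg_le d (F j)) ->
  coef_deg_le d (\sum_(j <- r | P j) F j).
Proof.
by move=> Fd k; rewrite coef_sum; apply: deg_le_sum => j Pj; apply: Fd.
Qed.

Lemma coef_deg_le_prod (J : Type) (r : seq J) (F : J -> {poly {mpoly K[n]}})
    (d : J -> nat) : (forall j, coef_deg_le (d j) (F j)) ->
  coef_deg_le (\sum_(j <- r) d j) (\prod_(j <- r) F j).
Proof.
move=> Fd; elim: r => [|j r IH] k.
  by rewrite !big_nil coef1; case: eqP => _; [apply: deg_le1 | apply: deg_le0].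
by rewrite !big_cons; apply: coef_deg_leM.
Qed.

Lemma coef_deg_leXn d (p : {poly {mpoly K[n]}}) k :
  coef_deg_le d p -> coef_deg_le (d * k) (p ^+ k).
Proof.
move=> pd; elim: k => [|k IH].
  move=> k; rewrite expr0 coef1.
  by case: eqP => _; [apply: deg_le1 | apply: deg_le0].
by rewrite exprS mulnS; apply: coef_deg_leM.
Qed.

End DegreeBounds.

(** * Nagata normalization *)

Lemma mpoly_morph_ext (K : fieldType) (n : nat) (A : comNzRingType)
    (f g : {rmorphism {mpoly K[n]} -> A}) :
    (forall c, f c%:MP = g c%:MP) -> (forall i, f 'X_i = g 'X_i) -> f =1 g.
Proof.
move=> fgC fgX p; rewrite [p]mpolyE !rmorph_sum; apply: eq_bigr => m _.
rewrite -mul_mpolyC !rmorphM /= fgC mpolyXE_id; congr (_ * _).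
by rewrite !rmorph_prod; apply: eq_bigr => i _; rewrite !rmorphXn /= fgX.
Qed.

Lemma digits_inj N k (a b : 'I_k -> nat) :
    (forall i, a i < N)%N -> (forall i, b i < N)%N ->
    (\sum_(i < k) a i * N ^ i = \sum_(i < k) b i * N ^ i)%N -> a =1 b.
Proof.
elim: k a b => [|k IH] a b aN bN; first by move=> _ [].
have split_sum (c : 'I_k.+1 -> nat) : (\sum_(i < k.+1) c i * N ^ i =
    N * (\sum_(i < k) c (lift ord0 i) * N ^ i) + c ord0)%N.
  rewrite big_ord_recl expn0 muln1 addnC; congr (_ + _)%N.
  rewrite big_distrr; apply: eq_bigr => i _.
  by rewrite expnS mulnCA.
rewrite !split_sum => E.
have E0 : a ord0 = b ord0.
  have := congr1 (modn^~ N) E; rewrite ![(N * _)%N]mulnC !modnMDl.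
  by rewrite !modn_small.
have N_gt0 : (0 < N)%N by apply: leq_ltn_trans (aN ord0).
have E1 : forall i, a (lift ord0 i) = b (lift ord0 i).
  apply: (IH (fun i => a (lift ord0 i))) => // ; move: E; rewrite E0.
  by move/addIn/eqP; rewrite eqn_pmul2l // => /eqP.
by move=> i; case: (unliftP ord0 i) => [j|] ->.
Qed.

Lemma digits_lt N k (a : 'I_k -> nat) :
  (forall i, a i < N)%N -> (\sum_(i < k) a i * N ^ i < N ^ k)%N.
Proof.
elim: k a => [|k IH] a aN; first by rewrite big_ord0.
rewrite big_ord_recr /= expnS.
have := IH (fun i => a (widen_ord (leqnSn k) i)) (fun i => aN _).
have := aN ord_max; move: (a ord_max) (\sum_(_ < _) _)%N => x y lt_x lt_y.
apply: (@leq_trans (N ^ k + x * N ^ k)%N); first by rewrite ltn_add2r.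
by rewrite -mulSn leq_mul2r lt_x orbT.
Qed.

Section Normalization.
Variables (K : fieldType) (n N : nat).
Hypothesis N_gt0 : (0 < N)%N.

Local Notation R := {mpoly K[n]}.
Local Notation S := {mpoly K[n.+1]}.

Definition norm_var (i : 'I_n.+1) : {poly R} :=
  if unlift ord0 i is Some j then ('X_j)%:P + 'X^(N ^ i) else 'X.

Definition unnorm_var (j : 'I_n) : S := 'X_(lift ord0 j) - 'X_ord0 ^+ (N ^ j.+1).

Definition const_poly (c : K) : {poly R} := (c%:MP)%:P.
HB.instance Definition _ := GRing.RMorphism.copy const_poly (polyC \o @mpolyC n K).

(** Nagata's change of variables: the first variable becomes x, and the i-th
    one is translated by x ^ (N ^ i).  It makes every nonzero polynomial of
    degree less than N monic in x, up to a constant, over any field. *)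
Definition normalize : S -> {poly R} := mmap const_poly norm_var.
HB.instance Definition _ := GRing.RMorphism.on normalize.

Definition unnorm_coef : R -> S := mmap (@mpolyC n.+1 K) unnorm_var.
HB.instance Definition _ := GRing.RMorphism.on unnorm_coef.

Definition unnormalize : {poly R} -> S :=
  horner_eval ('X_ord0 : S) \o map_poly unnorm_coef.
HB.instance Definition _ := GRing.RMorphism.on unnormalize.

Lemma normalizeK : cancel normalize unnormalize.
Proof.
apply: (mpoly_morph_ext (f := unnormalize \o normalize) (g := idfun)) => [c|i] /=.
  rewrite /normalize mmapC /unnormalize /= /horner_eval map_polyC /= hornerC.
  by rewrite /unnorm_coef mmapC.
rewrite /normalize mmapX mmap1U /norm_var.
case: unliftP => [j|] ->; last first.
  by rewrite /unnormalize /= /horner_eval map_polyX hornerX.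
rewrite /unnormalize /= /horner_eval rmorphD /= map_polyC map_polyXn hornerD.
rewrite hornerC hornerXn /= /unnorm_coef mmapX mmap1U /unnorm_var.
by rewrite subrK.
Qed.

(** The degree in x of the image of a monomial. *)
Definition weight (m : 'X_{1..n.+1}) : nat := (\sum_(i < n.+1) m i * N ^ i)%N.

Lemma norm_var_monic i : norm_var i \is monic /\ size (norm_var i) = (N ^ i).+1.
Proof.
rewrite /norm_var; case: unliftP => [j|] ->; last by rewrite monicX size_polyX.
have lt_s : (size (('X_j)%:P : {poly R}) <
             size ('X^(N ^ lift ord0 j) : {poly R}))%N.
  rewrite size_polyXn ltnS (leq_trans (size_polyC_leq1 _)) //.
  by rewrite expn_gt0 N_gt0.
split; last by rewrite addrC size_polyDl // size_polyXn.
by rewrite monicE addrC lead_coefDl // lead_coefXn.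
Qed.

Lemma normalize_monomial m :
  normalize 'X_[m] \is monic /\ size (normalize 'X_[m]) = (weight m).+1.
Proof.
rewrite /normalize mmapX /mmap1 /weight.
apply: (big_ind2 (fun (p : {poly R}) d => p \is monic /\ size p = d.+1)).
- by rewrite monic1 size_poly1.
- move=> p d q e [p_monic sp] [q_monic sq]; split; first by rewrite monicMr.
  by rewrite size_Mmonic ?monic_neq0 // sp sq addnS.
- move=> i _; have [v_monic sv] := norm_var_monic i; split; first exact: monic_exp.
  elim: (m i) => [|k IH]; first by rewrite expr0 size_poly1.
  rewrite exprS size_Mmonic ?monic_neq0 ?monic_exp // sv IH.
  by rewrite mulSn addSn addnS.
Qed.

Lemma normalize_coef_deg d f : deg_le d f -> coef_deg_le d (normalize f).
Proof.
move=> fd; rewrite /normalize /mmap.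
rewrite big_seq; apply: coef_deg_le_sum => m.
rewrite mcoeff_msupp => /(deg_leP fd) md k.
apply: (deg_leW md); move: k; rewrite -[mdeg m]add0n.
apply: coef_deg_leM => [k|].
  by rewrite coefC; case: eqP => _; [apply: deg_leC | apply: deg_le0].
rewrite mdegE; apply: coef_deg_le_prod => i.
rewrite -[X in coef_deg_le X _]mul1n; apply: coef_deg_leXn => k; rewrite /norm_var.
have X_le e : deg_le 1 (('X^e : {poly R})`_k).
  by rewrite coefXn; case: eqP => _; [apply: deg_le1 | apply: deg_le0].
case: unliftP => [j|] _; last exact: (X_le 1%N).
rewrite coefD coefC; apply: deg_leD => //.
by case: eqP => _; [apply: deg_leX | apply: deg_le0].
Qed.

Lemma normalizeE f : normalize f =
  \sum_(m <- msupp f) (f@_m)%:MP *: normalize 'X_[m].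
Proof.
rewrite /normalize {1}/mmap; apply: eq_bigr => m _.
by rewrite mmapX mul_polyC.
Qed.

Lemma normalize_size f : deg_le N.-1 f -> (size (normalize f) <= N ^ n.+1)%N.
Proof.
move=> fN; rewrite normalizeE big_seq; apply: (leq_trans (size_sum _ _ _)).
apply/bigmax_leqP_seq => m _; rewrite mcoeff_msupp => /(deg_leP fN) mN.
apply: (leq_trans (size_scale_leq _ _)).
rewrite (normalize_monomial m).2; apply: digits_lt => i.
rewrite -ltnS prednK // in mN; apply: leq_ltn_trans mN.
by rewrite mdegE (bigD1 i) //= leq_addr.
Qed.

(** Distinct monomials have distinct weights (these are base N expansions), so
    that the monomial of largest weight alone contributes to the leading term. *)
Lemma normalize_monic f : deg_le N.-1 f -> f != 0 ->
  exists2 c : K, c != 0 & const_poly c * normalize f \is monic.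
Proof.
move=> fN f0.
have lt_N m : m \in msupp f -> forall i, (m i < N)%N.
  rewrite mcoeff_msupp => /(deg_leP fN) mN i.
  rewrite -ltnS prednK // in mN; apply: leq_ltn_trans mN.
  by rewrite mdegE (bigD1 i) //= leq_addr.
have [M Mf M_max] : exists2 M, M \in msupp f &
    forall m, m \in msupp f -> (weight m <= weight M)%N.
  have: msupp f != [::] by rewrite msupp_eq0.
  elim: (msupp f) => // m s IH _; have [->|/IH[M Ms M_max]] := eqVneq s [::].
    by exists m; [rewrite inE | move=> m'; rewrite inE => /eqP->].
  have [le_m|lt_M] := leqP (weight m) (weight M).
    exists M; first by rewrite inE Ms orbT.
    by move=> m'; rewrite inE => /orP[/eqP-> // | /M_max].
  exists m; first by rewrite inE eqxx.
  move=> m'; rewrite inE => /orP[/eqP-> // | /M_max /leq_trans]; apply.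
  exact: ltnW.
have fM : f@_M != 0 by rewrite -mcoeff_msupp.
exists (f@_M)^-1; first by rewrite invr_eq0.
rewrite normalizeE (bigD1_seq M) ?msupp_uniq //= mulrDr.
rewrite {1}/const_poly -mul_polyC mulrA -!polyCM -mpolyCM mulVf // mpolyC1 mul1r.
have [XM_monic sM] := normalize_monomial M.
rewrite monicE lead_coefDl ?(eqP XM_monic) //.
rewrite sM ltnS /const_poly mul_polyC; apply: (leq_trans (size_scale_leq _ _)).
rewrite big_seq_cond; apply: (leq_trans (size_sum _ _ _)).
apply/bigmax_leqP_seq => m _ /andP[mf neM].
apply: (leq_trans (size_scale_leq _ _)).
rewrite (normalize_monomial m).2 ltn_neqAle M_max // andbT.
apply: contraNneq neM => /(digits_inj (lt_N m mf) (lt_N M Mf)) mM.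
by apply/eqP/mnmP.
Qed.

Lemma unnormalize_deg d e (p : {poly R}) : coef_deg_le d p -> (size p <= e)%N ->
  deg_le (d * N ^ n + e) (unnormalize p).
Proof.
move=> pd sp; rewrite /unnormalize /= /horner_eval horner_coef.
apply: deg_le_sum => i _.
have le_i : (i <= e)%N.
  apply: leq_trans (ltnW (ltn_ord i)) _; apply: leq_trans (size_poly _ _) sp.
rewrite coef_map; apply: deg_leM; last first.
  by apply: (deg_leW le_i); rewrite -[X in deg_le X _]mul1n; apply/deg_leXn/deg_leX.
rewrite /= /unnorm_coef /mmap big_seq; apply: deg_le_sum => m.
rewrite mcoeff_msupp => /(deg_leP (pd i)) md.
rewrite -[(d * _)%N]add0n; apply: deg_leM; first exact: deg_leC.
apply: (deg_leW (leq_mul md (leqnn _))).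
rewrite mdegE big_distrl /=; apply: deg_le_prod => j.
rewrite [X in deg_le X _]mulnC.
apply: deg_leXn; apply: deg_leD.
  by apply: deg_leW (deg_leX _ _); rewrite expn_gt0 N_gt0.
apply: deg_leN; apply: (@deg_leW _ _ (1 * N ^ j.+1)).
  by rewrite mul1n leq_pexp2l.
by apply: deg_leXn; apply: deg_leX.
Qed.

End Normalization.

(** * A degree bound for the Nullstellensatz *)

(** Multilinear expansion of a determinant whose rows are combinations of the
    vectors v_j: the Cauchy-Binet formula, with repetitions. *)
Lemma det_row_combinations (A : comNzRingType) (D : nat) (J : finType)
    (x : 'I_D -> J -> A) (v : J -> 'I_D -> A) :
  \det (\matrix_(c, r) \sum_j x c j * v j r) =
  \sum_(phi : {ffun 'I_D -> J})
    (\prod_c x c (phi c)) * \det (\matrix_(c, r) v (phi c) r).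
Proof.
under [RHS]eq_bigr do rewrite big_distrr.
rewrite exchange_big; apply: eq_bigr => s _ /=.
under eq_bigr => c _ do rewrite mxE.
rewrite bigA_distr_bigA big_distrr; apply: eq_bigr => phi _ /=.
rewrite big_split /= mulrCA; congr (_ * (_ * _)).
by apply: eq_bigr => c _; rewrite mxE.
Qed.

Section MonicElimination.
Variables (R : idomainType) (J : finType) (g : J -> {poly R}) (W : nat).
Hypothesis g_size : forall j, (size (g j) <= W)%N.
Variables (j0 : J) (u : R).
Hypothesis g_monic : u%:P * g j0 \is monic.

(** Every multiplier but that of the monic member g j0 can be reduced modulo
    this member, and then the multiplier of g j0 has small degree as well. *)
Lemma combination_of_small_degree (b : J -> {poly R}) (t : {poly R}) :
    (size t <= W + W)%N -> \sum_j b j * g j = t ->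
  exists2 a : J -> {poly R}, \sum_j a j * g j = t &
    forall j i, (a j)`_i != 0 -> (i < W + W)%N && (i + size (g j) <= W + W)%N.
Proof.
move=> size_t tE; set G := u%:P * g j0.
have G0 : G != 0 by apply: monic_neq0.
have [u0 gj0] : u != 0 /\ g j0 != 0.
  by move: G0; rewrite /G mulf_eq0 negb_or polyC_eq0 => /andP.
have size_G : size G = size (g j0) by rewrite /G mul_polyC size_scale.
have sg_gt0 : (0 < size (g j0))%N by rewrite size_poly_gt0.
pose q j := Pdiv.Ring.rdivp (b j) G; pose r j := Pdiv.Ring.rmodp (b j) G.
have bE j : b j = q j * G + r j by apply: Pdiv.RingMonic.rdivp_eq.
have size_r j : (size (r j) < size (g j0))%N.
  by rewrite -size_G Pdiv.Ring.ltn_rmodp.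
pose a j := if j == j0 then b j0 + u%:P * \sum_(k | k != j0) q k * g k else r j.
have aE : \sum_j a j * g j = t.
  rewrite -tE (bigD1 j0) //= [RHS](bigD1 j0) //= {1}/a eqxx.
  have -> : \sum_(j | j != j0) a j * g j = \sum_(j | j != j0) r j * g j.
    by apply: eq_bigr => j /negPf ne; rewrite /a ne.
  have -> : \sum_(j | j != j0) b j * g j =
      G * (\sum_(j | j != j0) q j * g j) + \sum_(j | j != j0) r j * g j.
    by rewrite mulr_sumr -big_split; apply: eq_bigr => j _; rewrite bE /=; ring.
  by rewrite /G; ring.
have size_prod_r j : (size (r j * g j)%R <= W + W)%N.
  apply: leq_trans (size_polyMleq _ _) _; apply: leq_trans (leq_pred _) _.
  by rewrite leq_add // (leq_trans (ltnW (size_r j))).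
exists a => // j i ai.
have lt_i : (i < size (a j))%N.
  by rewrite ltnNge; apply: contra ai => /(nth_default 0) ->.
have [Ej|ne] := eqVneq j j0; last first.
  move: lt_i; rewrite /a (negPf ne) => lt_i.
  have lt_iW : (i < W)%N.
    apply: leq_trans lt_i _; apply: leq_trans (ltnW (size_r j)) _.
    exact: g_size.
  have := g_size j; lia.
subst j; have a0 : a j0 != 0 by apply: contraNneq ai => ->; rewrite coef0.
have : (size (a j0 * g j0)%R <= W + W)%N.
  have -> : a j0 * g j0 = t - \sum_(j | j != j0) a j * g j.
    by rewrite -aE (bigD1 j0) //= addrK.
  apply: leq_trans (size_polyD _ _) _; rewrite geq_max size_t size_polyN.
  apply: leq_trans (size_sum _ _ _) _; apply/bigmax_leqP => j /negPf ne.
  by rewrite /a ne.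
by rewrite size_mul //; lia.
Qed.

End MonicElimination.

Lemma fin_exists_family (I : finType) (T : Type) (P : I -> T -> Prop) :
  (forall i, exists x, P i x) -> exists f : I -> T, forall i, P i (f i).
Proof. by move=> H; apply: (fin_all_exists H). Qed.

(** Here s bounds both the number of the polynomials and their degrees.  After
    normalization in base s + 1 they have degree less than W in x, and the
    matrix has D rows and at most s D columns with entries of degree at most s;
    so it has at most (s D) ^ D maximal minors, with repetitions, of degree at
    most D s.  The last product undoes the normalization. *)
Fixpoint cert_bound (n s : nat) : nat :=
  if n is n'.+1 then
    let W := (s.+1 ^ n)%N in let D := (W + W)%N in
    ((cert_bound n' ((s * D) ^ D + D * s) + D * s) * W + D)%N
  else 0%N.

(** If 1 is in the ideal generated by the f j, then it is a combination of them
    with multipliers of degree bounded in terms of the number of variables, the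
    number of polynomials and their degrees only.  The family is indexed by an
    arbitrary finite type because the induction applies to the minors, indexed
    by functions. *)
Theorem unit_combination_bounded (K : fieldType) n s (J : finType)
    (f : J -> {mpoly K[n]}) (b : J -> {mpoly K[n]}) :
    (#|J| <= s)%N -> (forall j, deg_le s (f j)) -> \sum_j b j * f j = 1 ->
  exists2 a : J -> {mpoly K[n]},
    \sum_j a j * f j = 1 & forall j, deg_le (cert_bound n s) (a j).
Proof.
elim: n s J f b => [|n IH] s J f b cardJ fs bf.
  exists b => // j; rewrite [b j]nvar0_mpolyC; exact: deg_leC.
set N := s.+1; have N_gt0 : (0 < N)%N by [].
pose W := (N ^ n.+1)%N; pose D := (W + W)%N.
have W_gt0 : (0 < W)%N by rewrite expn_gt0.
pose g j := normalize N (f j).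
have g_size j : (size (g j) <= W)%N by apply: normalize_size.
have g_deg j : coef_deg_le s (g j) by apply: normalize_coef_deg.
have [j0 fj0] : exists j0, f j0 != 0.
  apply: NNPP => none; move/eqP: bf; rewrite big1 ?(eq_sym 0) ?oner_eq0 // => j _.
  by have [->|fj] := eqVneq (f j) 0; [rewrite mulr0 | case: none; exists j].
have [c c0 g_monic] := normalize_monic N_gt0 (fs j0) fj0.
have bg : \sum_j normalize N (b j) * g j = 1.
  rewrite -[RHS](rmorph1 (normalize N)) -bf rmorph_sum.
  by apply: eq_bigr => j _; rewrite rmorphM.
pose represents (k : 'I_D) (a : J -> {poly {mpoly K[n]}}) :=
  \sum_j a j * g j = 'X^k /\ forall j i,
    (a j)`_i != 0 -> (i < D)%N && (i + size (g j) <= D)%N.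
have [x xP] : exists x, forall k, represents k (x k).
  apply: fin_exists_family => k.
  have [||a aE aP] := combination_of_small_degree g_size g_monic
      (t := 'X^k) (b := fun j => 'X^k * normalize N (b j)).
  - by rewrite size_polyXn.
  - by rewrite -[RHS]mulr1 -bg mulr_sumr; apply: eq_bigr => j _; rewrite mulrA.
  by exists a.
(* The columns of the matrix: the shifts of the g j of degree less than D, the
   other ones being replaced by 0 to keep a simple set of indices. *)
pose col (ji : J * 'I_D) : {poly {mpoly K[n]}} :=
  if (ji.2 + size (g ji.1) <= D)%N then 'X^(ji.2) * g ji.1 else 0.
have col_size ji : (size (col ji) <= D)%N.
  rewrite /col; case: ifP => [le_D|_]; last by rewrite size_poly0.
  apply: leq_trans (size_polyMleq _ _) _; rewrite size_polyXn addSn.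
  exact: le_D.
have col_deg ji : coef_deg_le s (col ji).
  rewrite /col; case: ifP => _ k; last by rewrite coef0; apply: deg_le0.
  by rewrite coefXnM; case: ifP => _; [apply: deg_le0 | apply: g_deg].
have col_sum k : \sum_(ji : J * 'I_D) (x k ji.1)`_(ji.2) *: col ji = 'X^k.
  have [<- xk] := xP k.
  rewrite -(pair_bigA _ (fun j (i : 'I_D) => (x k j)`_i *: col (j, i))) /=.
  apply: eq_bigr => j _.
  have {2}-> : x k j = \sum_(i < D) (x k j)`_i *: 'X^i.
    rewrite -poly_def; apply/polyP => i; rewrite coef_poly.
    case: ifP => // i_D; apply/eqP; apply: contraFT i_D.
    by case/xk/andP.
  rewrite mulr_suml; apply: eq_bigr => i _; rewrite /col /=.
  have [->|nz] := eqVneq ((x k j)`_i) 0; first by rewrite !scale0r mul0r.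
  by have /andP[_ ->] := xk _ _ nz; rewrite scalerAl.
pose M (phi : {ffun 'I_D -> J * 'I_D}) : 'M[{mpoly K[n]}]_D :=
  \matrix_(k, r) (col (phi k))`_r.
have M_unit : \sum_(phi : {ffun 'I_D -> J * 'I_D})
    (\prod_k (x k (phi k).1)`_(phi k).2) * \det (M phi) = 1.
  rewrite -(det_row_combinations (fun k (ji : J * 'I_D) => (x k ji.1)`_(ji.2))
             (fun ji r => (col ji)`_r)).
  rewrite -[RHS](det1 _ D); congr (\det _); apply/matrixP => k r.
  rewrite !mxE; have := congr1 (fun p : {poly _} => p`_r) (col_sum k).
  rewrite coef_sum coefXn eq_sym -val_eqE => <-.
  by apply: eq_bigr => ji _; rewrite coefZ.
set s' := ((s * D) ^ D + D * s)%N.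
have card_phi : (#|{ffun 'I_D -> J * 'I_D}| <= s')%N.
  rewrite card_ffun card_prod !card_ord; apply: leq_trans (leq_addr _ _).
  by rewrite leq_exp2r ?leq_mul2r ?cardJ ?orbT // /D addn_gt0 W_gt0.
have M_deg phi : forall k r, deg_le s (M phi k r).
  by move=> k r; rewrite mxE; apply: col_deg.
have [|e e_unit e_deg] := IH s' _ _ _ card_phi _ M_unit.
  by move=> phi; apply: deg_leW (deg_le_det (M_deg phi)); rewrite leq_addl.
have D_gt0 : (0 < D)%N by rewrite addn_gt0 W_gt0.
pose o : 'I_D := Ordinal D_gt0.
(* A minor, as a constant polynomial, is a combination of its columns: this is
   the first row of the product with the adjugate. *)
have adj_col phi : \sum_k (\adj (M phi)) o k *: col (phi k) = (\det (M phi))%:P.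
  apply/polyP => r; rewrite coef_sum coefC.
  under eq_bigr => k _ do rewrite coefZ.
  have [lt_r|le_r] := ltnP r D; last first.
    rewrite big1 => [|k _]; last first.
      by rewrite [_`_r]nth_default ?mulr0 ?(leq_trans (col_size _)).
    by case: eqP => // r0; rewrite r0 leqNgt D_gt0 in le_r.
  have := congr1 (fun A : 'M_D => A o (Ordinal lt_r)) (mul_adj_mx (M phi)).
  rewrite !mxE => E; transitivity (\det (M phi) *+ (o == Ordinal lt_r)); last first.
    by rewrite -val_eqE /= eq_sym; case: eqP.
  by rewrite -E; apply: eq_bigr => k _; rewrite [M phi k _]mxE.
pose A j : {poly {mpoly K[n]}} := \sum_(phi : {ffun 'I_D -> J * 'I_D}) \sum_k
  if ((phi k).1 == j) && ((phi k).2 + size (g (phi k).1) <= D)%N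
  then (e phi * (\adj (M phi)) o k) *: 'X^((phi k).2) else 0.
have A_sum : \sum_j A j * g j = 1.
  rewrite -[RHS]polyC1 -e_unit rmorph_sum /=.
  under eq_bigr => j _ do rewrite mulr_suml.
  rewrite exchange_big; apply: eq_bigr => phi _ /=.
  under eq_bigr => j _ do rewrite mulr_suml.
  rewrite exchange_big polyCM -adj_col mulr_sumr; apply: eq_bigr => k _ /=.
  rewrite (bigD1 (phi k).1) //= eqxx /= big1 => [|j ne]; last first.
    by rewrite eq_sym (negPf ne) mul0r.
  rewrite addr0 /col; case: ifP => _; last by rewrite mul0r scaler0 mulr0.
  by rewrite -scalerA mul_polyC -scalerAl -scalerAl.
have A_size j : (size (A j) <= D)%N.
  do 2![apply: (leq_trans (size_sum _ _ _)); apply/bigmax_leqP => ? _].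
  case: ifP => _; last by rewrite size_poly0.
  by apply: leq_trans (size_scale_leq _ _) _; rewrite size_polyXn.
have A_deg j : coef_deg_le (cert_bound n s' + D * s) (A j).
  apply: coef_deg_le_sum => phi _; apply: coef_deg_le_sum => k _ i.
  case: ifP => _; last by rewrite coef0; apply: deg_le0.
  rewrite coefZ coefXn; case: eqP => _; last by rewrite mulr0; apply: deg_le0.
  by rewrite mulr1; apply: deg_leM => //; apply: deg_le_adj.
exists (fun j => unnormalize N (A j)).
  transitivity (unnormalize N (\sum_j A j * g j)); last by rewrite A_sum rmorph1.
  rewrite rmorph_sum; apply: eq_bigr => j _.
  by rewrite rmorphM [X in _ = _ * X]normalizeK.
move=> j; apply: deg_leW (unnormalize_deg N_gt0 (A_deg j) (A_size j)).
rewrite /cert_bound -/cert_bound leq_add2r leq_mul2l; apply/orP; right.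
by rewrite /W leq_pexp2l.
Qed.

(** * Rabinowitsch's trick: bounded certificates of collapse *)

Local Notation "x %:F" := (tofrac x).

Section Rabinowitsch.
Variables (K : fieldType) (n : nat) (q : {mpoly K[n]}).
Hypothesis q0 : q != 0.

Local Notation R := {mpoly K[n]}.
Local Notation S := {mpoly K[n.+1]}.
Local Notation widen := (widen_ord (leqnSn n)).

Definition inv_var (i : 'I_n.+1) : {fraction R} :=
  if unlift ord_max i is Some j then ('X_j)%:F else (q%:F)^-1.

Definition frac_const (c : K) : {fraction R} := (c%:MP)%:F.
HB.instance Definition _ :=
  GRing.RMorphism.copy frac_const (@tofrac _ \o @mpolyC n K).

Definition inv_subst : S -> {fraction R} := mmap frac_const inv_var.
HB.instance Definition _ := GRing.RMorphism.on inv_subst.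

Lemma inv_var_widen j : inv_var (widen j) = ('X_j)%:F.
Proof.
rewrite /inv_var; have -> : widen j = lift ord_max j.
  by apply: val_inj; rewrite /= /bump leqNgt ltn_ord.
by rewrite liftK.
Qed.

Lemma inv_var_max : inv_var ord_max = (q%:F)^-1.
Proof. by rewrite /inv_var unlift_none. Qed.

Lemma inv_subst_widen p : inv_subst (mwiden p) = p%:F.
Proof.
apply: (mpoly_morph_ext (f := inv_subst \o @mwiden n K) (g := @tofrac R)) => [c|i] /=.
  by rewrite mwidenC /inv_subst mmapC.
by rewrite mwidenX mnmwiden1 /inv_subst mmapX mmap1U inv_var_widen.
Qed.

Lemma inv_substX : inv_subst 'X_ord_max = (q%:F)^-1.
Proof. by rewrite /inv_subst mmapX mmap1U inv_var_max. Qed.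

Lemma clear_denominators B s E (a : S) : deg_le B a -> deg_le s q -> (B <= E)%N ->
  exists2 a' : R, a'%:F = q%:F ^+ E * inv_subst a & deg_le (B + s * E) a'.
Proof.
move=> aB qs BE.
have qF : q%:F != 0 by rewrite tofrac_eq0.
pose mon (m : 'X_{1..n.+1}) : R :=
  (\prod_(j < n) 'X_j ^+ m (widen j)) * q ^+ (E - m ord_max).
have monE (m : 'X_{1..n.+1}) : (m ord_max <= E)%N ->
    (mon m)%:F = q%:F ^+ E * inv_subst 'X_[m].
  move=> mE; rewrite /inv_subst mmapX /mmap1 big_ord_recr /= inv_var_max.
  rewrite /mon rmorphM rmorph_prod mulrCA; congr (_ * _).
    by apply: eq_bigr => j _; rewrite rmorphXn inv_var_widen.
  by rewrite rmorphXn /= expfB_cond ?(negPf qF) // exprVn.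
exists (\sum_(m <- msupp a) a@_m *: mon m).
  have -> : inv_subst a =
      \sum_(m <- msupp a) (a@_m)%:MP%:F * inv_subst 'X_[m].
    by apply: eq_bigr => m _; rewrite /inv_subst mmapX.
  rewrite rmorph_sum mulr_sumr /= big_seq [RHS]big_seq.
  apply: eq_bigr => m; rewrite mcoeff_msupp => /(deg_leP aB) mB.
  rewrite -[_ *: mon m]mul_mpolyC rmorphM /= mulrCA monE //.
  apply: leq_trans BE; apply: leq_trans mB.
  by rewrite mdegE (bigD1 ord_max) //= leq_addr.
rewrite big_seq; apply: deg_le_sum => m; rewrite mcoeff_msupp => /(deg_leP aB) mB.
rewrite -mul_mpolyC -[X in deg_le X _]add0n; apply: deg_leM; first exact: deg_leC.
apply: deg_leM; last first.
  apply: (@deg_leW _ _ (s * (E - m ord_max))); last exact: deg_leXn.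
  by rewrite leq_mul2l leq_subr orbT.
apply: (deg_leW mB); apply: (@deg_leW _ _ (\sum_(j < n) m (widen j))).
  by rewrite mdegE big_ord_recr /= leq_addr.
apply: deg_le_prod => j; rewrite -[X in deg_le X _]mul1n.
by apply: deg_leXn; apply: deg_leX.
Qed.

End Rabinowitsch.

(** In an identity 1 = sum_i b_i p_i + b_0 (1 - t q) of bounded degree, t is
    replaced by 1/q and the denominators are cleared by a power of q. *)
Lemma power_in_ideal_bounded (K : fieldType) n s k (p : 'I_k -> {mpoly K[n]}) q
    (B := cert_bound n.+1 s) (b : 'I_k -> {mpoly K[n.+1]}) (b0 : {mpoly K[n.+1]}) :
    (k < s)%N -> (forall i, deg_le s (p i)) -> deg_le s.-1 q ->
    \sum_i b i * mwiden (p i) + b0 * (1 - 'X_ord_max * mwiden q) = 1 ->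
  exists2 a, q ^+ B.+1 = \sum_i a i * p i & forall i, deg_le (B + s * B.+1) (a i).
Proof.
move=> ks ps qs bE.
have deg_widen e (r : {mpoly K[n]}) : deg_le e r -> deg_le e (mwiden r).
  move=> re; rewrite [r]mpolyE rmorph_sum big_seq; apply: deg_le_sum => m.
  rewrite mcoeff_msupp => /(deg_leP re) me; rewrite /= mwidenZ mwidenX.
  rewrite -mul_mpolyC -[X in deg_le X _]add0n; apply: deg_leM; first exact: deg_leC.
  apply: (deg_leW me); rewrite /deg_le msizeX ltnS !mdegE big_ord_recr /=.
  by rewrite mnmwiden_ordmax addn0 leq_sum // => j _; rewrite mnmwiden_widen.
have [->|q0] := eqVneq q 0.
  (* The exponent is positive in order to cover this case. *)
  exists (fun=> 0); last by move=> i; apply: deg_le0.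
  by rewrite expr0n big1 // => i _; rewrite mul0r.
pose f (o : option 'I_k) : {mpoly K[n.+1]} :=
  if o is Some i then mwiden (p i) else 1 - 'X_ord_max * mwiden q.
have fs o : deg_le s (f o).
  case: o => [i|] /=; first exact: deg_widen.
  apply: deg_leD; first exact: deg_le1.
  apply: deg_leN; apply: (@deg_leW _ _ (1 + s.-1)).
    by rewrite add1n (ltn_predK ks).
  apply: deg_leM; first exact: deg_leX.
  exact: deg_widen.
have sum_option (V : nmodType) (F : option 'I_k -> V) :
    \sum_o F o = \sum_i F (Some i) + F None.
  rewrite (bigD1 None) //= addrC; congr (_ + _).
  rewrite (reindex_omap Some id) //=; last by case.
  by apply: eq_bigl => i; rewrite eqxx.
have [||a aE aB] := @unit_combination_bounded K n.+1 s _ f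
    (fun o => if o is Some i then b i else b0) _ fs.
- by rewrite card_option card_ord.
- by rewrite sum_option.
have qs' : deg_le s q by apply: deg_leW qs; apply: leq_pred.
have [a' a'E a'B] : exists2 a' : 'I_k -> {mpoly K[n]},
    forall i, (a' i)%:F = q%:F ^+ B.+1 * inv_subst q (a (Some i)) &
    forall i, deg_le (B + s * B.+1) (a' i).
  have /fin_exists_family[a' a'P] : forall i, exists a' : {mpoly K[n]},
      a'%:F = q%:F ^+ B.+1 * inv_subst q (a (Some i)) /\ deg_le (B + s * B.+1) a'.
    move=> i; have [a' ? ?] := clear_denominators q0 (aB (Some i)) qs' (leqnSn B).
    by exists a'.
  by exists a' => i; case: (a'P i).
exists a' => //; apply/eqP; rewrite -tofrac_eq rmorph_sum rmorphXn; apply/eqP.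
have := congr1 (inv_subst q) aE; rewrite sum_option rmorphD /= rmorph_sum rmorph1.
rewrite [X in _ + X]rmorphM rmorphB rmorphM /= inv_substX inv_subst_widen.
rewrite mulVf ?tofrac_eq0 // rmorph1 subrr mulr0 addr0 => E.
rewrite -[LHS]mulr1 -E mulr_sumr; apply: eq_bigr => i _.
by rewrite !rmorphM /= a'E inv_subst_widen mulrA.
Qed.

(** Unless the ideal I generated by R0 and 1 - t q is the unit ideal, K[x, t] is
    a model of the presentation modulo I: there, the inverse of a factor r of q
    is t times the product of the other factors. *)
Theorem collapse_certificate_bounded (K : fieldType) n s (R0 Rn0 : seq {mpoly K[n]})
    (B := cert_bound n.+1 s) :
    (size R0 < s)%N -> (forall p, p \in R0 -> deg_le s p) ->
    deg_le s.-1 (\prod_(q <- Rn0) q) ->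
    collapses ACF (dg_presentation R0 Rn0) ->
  exists2 a : 'I_(size R0) -> {mpoly K[n]},
    (\prod_(q <- Rn0) q) ^+ B.+1 = \sum_i a i * R0`_i &
    forall i, deg_le (B + s * B.+1) (a i).
Proof.
move=> R0s R0_deg q_deg coll; set q := \prod_(q <- Rn0) q in q_deg *.
pose k := size R0; pose p (i : 'I_k) := R0`_i.
pose I (z : {mpoly K[n.+1]}) := exists (b : 'I_k -> {mpoly K[n.+1]}) b0,
  z = \sum_i b i * mwiden (p i) + b0 * (1 - 'X_ord_max * mwiden q).
have I_ideal : is_ideal I.
  split.
  - exists (fun=> 0), 0; rewrite mul0r addr0 big1 // => i _; exact: mul0r.
  - move=> _ _ [b [b0 ->]] [c [c0 ->]]; exists (fun i => b i + c i), (b0 + c0).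
    by under [in RHS]eq_bigr do rewrite mulrDl; rewrite big_split /=; ring.
  - move=> e _ [b [b0 ->]]; exists (fun i => e * b i), (e * b0).
    by under [in RHS]eq_bigr do rewrite -mulrA; rewrite -mulr_sumr; ring.
have [[b [b0 bE]]|I1] := classic (I 1).
  apply: (power_in_ideal_bounded R0s _ q_deg (esym bE)) => i.
  by apply: R0_deg; apply: mem_nth.
pose nu (v : K + 'I_n) : {mpoly K[n.+1]} :=
  match v with inl c => c%:MP | inr i => mwiden 'X_i end.
have liftE r : zeval nu (lift_poly r) = mwiden r.
  rewrite /lift_poly /mpoly.mmap zeval_sum [in RHS](mpolyE r).
  rewrite rmorph_sum; apply: eq_bigr => m _.
  rewrite zevalM zevalX /= mwidenZ -mul_mpolyC; congr (_ * _).
  rewrite /mmap1 zeval_prod mpolyXE_id rmorph_prod.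
  by apply: eq_bigr => i _; rewrite zeval_exp zevalX rmorphXn.
have I_R0 r : r \in R0 -> I (mwiden r).
  move=> rR0; have ltk : (index r R0 < k)%N by rewrite index_mem.
  exists (fun i => (i == Ordinal ltk)%:R), 0; rewrite mul0r addr0.
  rewrite (bigD1 (Ordinal ltk)) //= eqxx mul1r big1 ?addr0 => [|i /negPf->].
    by rewrite /p nth_index.
  by rewrite mul0r.
case: (model_not_collapses I_ideal I1 (nu := nu) _ coll) => a.
have constE (z : ZZ[K]) : zeval nu (zrename inl z) = (zeval id z)%:MP.
  by rewrite zeval_rename -(zeval_morph (@mpolyC n.+1 K)).
case=> [[b bP ->]|].
  case: b bP => z /= zP; rewrite constE.
    by rewrite zP mpolyC0; apply: ideal_zero.
  exists ((zeval id z)^-1%:MP); rewrite -mpolyCM mulfV; last exact/eqP.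
  by rewrite mpolyC1 subrr; apply: ideal_zero.
case: a => z [r rR ->] /=; rewrite liftE; first exact: I_R0.
exists ('X_ord_max * mwiden (\prod_(x <- rem r Rn0) x)).
exists (fun=> 0), (-1).
rewrite [X in _ = X + _]big1 => [|i _]; last exact: mul0r.
rewrite /q (perm_big _ (perm_to_rem rR)) big_cons rmorphM /=; ring.
Qed.

(** * Programs for the arithmetic of polynomials *)

(* The variable v_i is the one bound by the i-th enclosing abstraction, counted
   from the innermost one; so, in the step of a recursion on a list, v0 is the
   recursive value, v1 the tail and v2 the head. *)
Local Notation "f $ a" := (PApp f a) (at level 11, left associativity).
Local Notation natrec z f k := (PNatRec _ _ $ z $ f $ k).
Local Notation listrec z f l := (PListRec _ _ _ $ z $ f $ l).
Local Notation pair a b := (PPair _ _ _ $ a $ b).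
Local Notation pcons a l := (PCons _ _ $ a $ l).
Local Notation fst a := (PFst _ _ _ $ a).
Local Notation snd a := (PSnd _ _ _ $ a).
Local Notation lam b := (PLam b).
Local Notation v0 := (PVar (PVz _ _)).
Local Notation v1 := (PVar (PVs _ (PVz _ _))).
Local Notation v2 := (PVar (PVs _ (PVs _ (PVz _ _)))).
Local Notation v3 := (PVar (PVs _ (PVs _ (PVs _ (PVz _ _))))).
Local Notation v4 := (PVar (PVs _ (PVs _ (PVs _ (PVs _ (PVz _ _)))))).
Local Notation v5 := (PVar (PVs _ (PVs _ (PVs _ (PVs _ (PVs _ (PVz _ _))))))).
Local Notation v6 := (PVar (PVs _ (PVs _ (PVs _ (PVs _ (PVs _ (PVs _ (PVz _ _)))))))).
Local Infix "-->" := SArr (at level 55, right associativity).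

Section Programs.
Variable G : seq Defs.sort.

Definition t_add : prog G (SNat --> SNat --> SNat) :=
  lam (lam (natrec v1 (lam (lam (PSucc _ $ v0))) v0)).

Definition t_pred : prog G (SNat --> SNat) :=
  lam (natrec (PZero _) (lam (lam v1)) v0).

Definition t_ifz s : prog G (SNat --> s --> s --> s) :=
  lam (lam (lam (natrec v1 (lam (lam v2)) v2))).

End Programs.

Arguments t_add {G}.
Arguments t_pred {G}.
Arguments t_ifz {G s}.

Section Programs.
Variable G : seq Defs.sort.

Definition t_mul : prog G (SNat --> SNat --> SNat) :=
  lam (lam (natrec (PZero _) (lam (lam (t_add $ v3 $ v0))) v0)).

Definition t_sub : prog G (SNat --> SNat --> SNat) :=
  lam (lam (natrec v1 (lam (lam (t_pred $ v0))) v0)).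

Definition t_nth : prog G (SList SNat --> SNat --> SNat) :=
  lam (listrec (lam (PZero _))
         (lam (lam (lam (lam (natrec v3 (lam (lam (v3 $ v1))) v0))))) v0).

End Programs.
Arguments t_mul {G}.
Arguments t_sub {G}.
Arguments t_nth {G}.

Section Programs.
Variable G : seq Defs.sort.

Definition t_exp : prog G (SNat --> SNat --> SNat) :=
  lam (lam (natrec (PSucc _ $ PZero _) (lam (lam (t_mul $ v3 $ v0))) v0)).

(** The l^1 distance between two lists read as exponents of n variables: its
    vanishing is the test of equality of two monomials. *)
Definition t_dist : prog G (SNat --> SList SNat --> SList SNat --> SNat) :=
  lam (lam (lam (natrec (PZero _)
    (lam (lam (t_add $ v0
      $ (t_add $ (t_sub $ (t_nth $ v3 $ v1) $ (t_nth $ v2 $ v1))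
               $ (t_sub $ (t_nth $ v2 $ v1) $ (t_nth $ v3 $ v1))))))
    v2))).
End Programs.
Arguments t_exp {G}.
Arguments t_dist {G}.

Section Specs.
Variables (K : fieldType) (G : seq Defs.sort) (e : penv K G).

Lemma t_addE m n : prog_eval t_add e m n = (m + n)%N.
Proof. by elim: n => [|n IH] /=; rewrite ?addn0 // addnS -IH. Qed.

Lemma t_predE m : prog_eval t_pred e m = m.-1.
Proof. by case: m. Qed.

Lemma t_ifzE s k (a b : interp K s) :
  prog_eval t_ifz e k a b = if k == 0%N then a else b.
Proof. by case: k. Qed.
End Specs.
Opaque t_add t_pred t_ifz.

Section Specs.
Variables (K : fieldType) (G : seq Defs.sort) (e : penv K G).
Lemma t_mulE m n : prog_eval t_mul e m n = (m * n)%N.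
Proof. by elim: n => [|n IH] /=; rewrite ?muln0 // t_addE mulnS -IH. Qed.

Lemma t_subE m n : prog_eval t_sub e m n = (m - n)%N.
Proof. by elim: n => [|n IH] /=; rewrite ?subn0 // t_predE subnS -IH. Qed.

Lemma t_nthE l i : prog_eval t_nth e l i = nth 0%N l i.
Proof. by elim: l i => [|x l IH] [|i] //=; rewrite -IH. Qed.
End Specs.
Opaque t_mul t_sub t_nth.

Section Specs.
Variables (K : fieldType) (G : seq Defs.sort) (e : penv K G).

Lemma t_expE m n : prog_eval t_exp e m n = (m ^ n)%N.
Proof. by elim: n => [|n IH] //=; rewrite t_mulE expnS -IH. Qed.

Definition mono n (l : seq nat) : 'X_{1..n} := [multinom nth 0%N l i | i < n].

Lemma t_distE n l l' : (prog_eval t_dist e n l l' == 0%N) = (mono n l == mono n l').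
Proof.
have -> : prog_eval t_dist e n l l' = (\sum_(i < n)
    ((nth 0 l i - nth 0 l' i) + (nth 0 l' i - nth 0 l i)))%N.
  elim: n => [|n IH] /=; first by rewrite big_ord0.
  by rewrite big_ord_recr !t_addE !t_subE !t_nthE -IH.
rewrite sum_nat_eq0; apply/forallP/eqP => [H|/mnmP H i].
  apply/mnmP => i; rewrite !mnmE; have := H i; rewrite implyTb addn_eq0 !subn_eq0.
  by rewrite -eqn_leq => /eqP.
by have := H i; rewrite !mnmE => ->; rewrite subnn.
Qed.
End Specs.
Opaque t_exp t_dist.

Section Programs.
Variable G : seq Defs.sort.

Definition t_coef : prog G (SNat --> SList SNat --> SPoly --> SFld) :=
  lam (lam (lam (listrec (PFZero _)
    (lam (lam (lam (t_ifz $ (t_dist $ v5 $ fst v2 $ v4)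
                      $ (PFAdd _ $ snd v2 $ v0) $ v0)))) v0))).

Definition t_map s s' : prog G ((s --> s') --> SList s --> SList s') :=
  lam (lam (listrec (PNil _ _) (lam (lam (lam (pcons (v4 $ v2) v0)))) v0)).

Definition t_cat s : prog G (SList s --> SList s --> SList s) :=
  lam (lam (listrec v0 (lam (lam (lam (pcons v2 v0)))) v1)).

Definition t_addexp : prog G (SList SNat --> SList SNat --> SList SNat) :=
  lam (listrec (lam v0)
    (lam (lam (lam (lam (listrec (pcons v3 v2)
       (lam (lam (lam (pcons (t_add $ v6 $ v2) (v4 $ v1))))) v0))))) v0).

End Programs.
Arguments t_coef {G}.
Arguments t_map {G s s'}.
Arguments t_cat {G s}.
Arguments t_addexp {G}.

Section Programs.
Variable G : seq Defs.sort.

Definition t_scale : prog G (SFld --> SPoly --> SPoly) :=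
  lam (lam (t_map $ lam (pair (fst v0) (PFMul _ $ v2 $ snd v0)) $ v0)).

Definition t_flatten s : prog G (SList (SList s) --> SList s) :=
  lam (listrec (PNil _ _) (lam (lam (lam (t_cat $ v2 $ v0)))) v0).

Definition t_pmul : prog G (SPoly --> SPoly --> SPoly) :=
  lam (lam (listrec (PNil _ _)
    (lam (lam (lam (t_cat $ (t_map $ lam (pair (t_addexp $ fst v3 $ fst v0)
                                              (PFMul _ $ snd v3 $ snd v0)) $ v3)
                     $ v0)))) v1)).

Definition t_rep s : prog G (SList s --> SNat --> SList s) :=
  lam (lam (natrec (PNil _ _) (lam (lam (t_cat $ v3 $ v0))) v0)).

Definition t_box : prog G (SNat --> SNat --> SList (SList SNat)) :=
  lam (lam (natrec (pcons (PNil _ _) (PNil _ _))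
    (lam (lam (natrec (PNil _ _)
      (lam (lam (t_cat $ (t_map $ lam (pcons v2 v0) $ v2) $ v0))) v2))) v1)).

End Programs.
Arguments t_scale {G}.
Arguments t_flatten {G s}.
Arguments t_pmul {G}.
Arguments t_rep {G s}.
Arguments t_box {G}.

Definition t_prod {G} : prog G (SList SPoly --> SPoly) :=
  lam (listrec (pcons (pair (PNil _ _) (PFOne _)) (PNil _ _))
         (lam (lam (lam (t_pmul $ v2 $ v0)))) v0).

Section Decode.
Variables (K : fieldType) (n : nat).
Implicit Types r : interp K SPoly.

Lemma decode_nil : decode n ([::] : interp K SPoly) = 0.
Proof. exact: big_nil. Qed.

Lemma decode_cons mc r :
  decode n ((mc :: r) : interp K SPoly) = mc.2 *: 'X_[mono n mc.1] + decode n r.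
Proof. exact: big_cons. Qed.

Lemma decode_cat r r' :
  decode n ((r ++ r') : interp K SPoly) = decode n r + decode n r'.
Proof. exact: big_cat. Qed.

End Decode.

Section Specs.
Variables (K : fieldType) (G : seq Defs.sort) (e : penv K G) (n : nat).

Lemma t_coefE l r : prog_eval t_coef e n l r = (decode n r)@_(mono n l).
Proof.
elim: r => [|mc r IH] /=; first by rewrite decode_nil mcoeff0.
rewrite t_ifzE t_distE decode_cons mcoeffD mcoeffZ mcoeffX -IH.
by case: eqP => _; rewrite ?mulr1 // mulr0 add0r.
Qed.

Lemma t_mapE s s' (f : interp K s -> interp K s') l :
  prog_eval t_map e f l = [seq f x | x <- l].
Proof. by elim: l => //= x l <-. Qed.

Lemma t_catE s (l l' : interp K (SList s)) : prog_eval t_cat e l l' = l ++ l'.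
Proof. by elim: l => //= x l <-. Qed.

Lemma t_addexpE l l' :
  mono n (prog_eval t_addexp e l l') = (mono n l + mono n l')%MM.
Proof.
suff E i : nth 0%N (prog_eval t_addexp e l l') i = (nth 0 l i + nth 0 l' i)%N.
  by apply/mnmP => i; rewrite mnmDE !mnmE E.
elim: l l' i => [|x l IH] [|y l'] [|i] //=; rewrite ?nth_nil ?addn0 ?add0n //.
  by rewrite t_addE.
exact: IH.
Qed.
End Specs.
Opaque t_coef t_map t_cat t_addexp.

Section Specs.
Variables (K : fieldType) (G : seq Defs.sort) (e : penv K G) (n : nat).

Lemma t_scaleE c r : decode n (prog_eval t_scale e c r) = c *: decode n r.
Proof.
rewrite /= t_mapE /decode big_map scaler_sumr.
by apply: eq_bigr => mc _ /=; rewrite scalerA.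
Qed.

Lemma t_flattenE s (l : interp K (SList (SList s))) :
  prog_eval t_flatten e l = flatten l.
Proof. by elim: l => //= x l IH; rewrite t_catE -IH. Qed.

Lemma t_pmulE r r' : decode n (prog_eval t_pmul e r r') = decode n r * decode n r'.
Proof.
elim: r => [|mc r IH] /=; first by rewrite decode_nil mul0r.
rewrite t_catE t_mapE decode_cat IH decode_cons mulrDl; congr (_ + _).
rewrite {1}/decode big_map [decode n r']/decode mulr_sumr.
apply: eq_bigr => mc' _ /=; rewrite -/(mono n _) t_addexpE.
by rewrite -scalerAl -scalerAr scalerA mpolyXD.
Qed.

Lemma t_repE s (l : interp K (SList s)) k :
  prog_eval t_rep e l k = flatten (nseq k l).
Proof. by elim: k => //= k IH; rewrite t_catE -IH. Qed.

Lemma t_boxE D (m : 'X_{1..n}) : (forall i, m i < D)%N ->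
  exists2 l, l \in (prog_eval t_box e n D : seq (seq nat)) & mono n l = m.
Proof.
move=> mD; exists (m : seq nat); last first.
  by apply/mnmP => i; rewrite mnmE -mnm_nth.
have sm : size (m : seq nat) = n by rewrite size_tuple.
have {}mD : all (fun x => x < D)%N (m : seq nat).
  apply/(all_nthP 0%N) => i; rewrite sm => i_n.
  by rewrite -(mnm_nth 0 m (Ordinal i_n)).
elim: {m}n (m : seq nat) sm mD => [|k IH] [|x l] //= [sl] /andP[xD lD].
have {IH} /= := IH l sl lD; move: (nat_rect _ _ _ k) => L lL.
elim: D xD {lD} => //= D IH; rewrite t_catE t_mapE mem_cat ltnS leq_eqVlt.
case/orP => [/eqP <-|/IH ->]; last by rewrite orbT.
by rewrite (map_f (cons x)).
Qed.
End Specs.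
Opaque t_scale t_flatten t_pmul t_rep t_box.

Lemma t_prodE (K : fieldType) G (e : penv K G) n (s : interp K (SList SPoly)) :
  decode n (prog_eval t_prod e s) = \prod_(r <- s) decode n r.
Proof.
elim: s => [|r s IH] /=; last by rewrite t_pmulE IH big_cons.
rewrite big_nil decode_cons decode_nil addr0 scale1r.
rewrite (_ : mono n [::] = 0%MM) ?mpolyX0 //.
by apply/mnmP => i; rewrite !mnmE nth_nil.
Qed.
Opaque t_prod.

(** * Bounding the degrees and the number of the given polynomials *)

(** The recursion of [cert_bound], applied to the function that bounds the
    degrees for one variable less; the two redexes name W and D. *)
Definition t_bound_step {G} : prog G ((SNat --> SNat) --> SNat --> SNat --> SNat) :=
  lam (lam (lam
    (lam (lam (t_add
         $ (t_mul $ (t_add $ (v4 $ (t_add $ (t_exp $ (t_mul $ v2 $ v0) $ v0)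
                                          $ (t_mul $ v0 $ v2)))
                           $ (t_mul $ v0 $ v2))
                  $ v1)
         $ v0) $ (t_add $ v0 $ v0))
       $ (t_exp $ (PSucc _ $ v0) $ (PSucc _ $ v1))))).

Section Programs.
Variable G : seq Defs.sort.

Definition t_bound : prog G (SNat --> SNat --> SNat) :=
  lam (natrec (lam (PZero _)) (lam (lam (t_bound_step $ v0 $ v1))) v0).

Definition t_sum : prog G (SList SNat --> SNat) :=
  lam (listrec (PZero _) (lam (lam (lam (t_add $ v2 $ v0)))) v0).

Definition t_length s : prog G (SList s --> SNat) :=
  lam (listrec (PZero _) (lam (lam (lam (PSucc _ $ v0)))) v0).

End Programs.
Arguments t_bound {G}.
Arguments t_sum {G}.
Arguments t_length {G s}.

Definition t_total {G} : prog G (SList SPoly --> SNat) :=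
  lam (t_sum $ (t_map $ lam (t_sum $ (t_map $ lam (t_sum $ fst v0) $ v0)) $ v0)).

Lemma t_bound_stepE (K : fieldType) G (e : penv K G) rec n s :
  prog_eval t_bound_step e rec n s =
  let W := (s.+1 ^ n.+1)%N in let D := (W + W)%N in
  ((rec ((s * D) ^ D + D * s) + D * s) * W + D)%N.
Proof. by rewrite /= !(t_addE, t_mulE, t_expE). Qed.

Opaque t_bound_step.

Section Specs.
Variables (K : fieldType) (G : seq Defs.sort) (e : penv K G).

Lemma t_boundE n s : prog_eval t_bound e n s = cert_bound n s.
Proof.
rewrite /=; move: {1}n => k; elim: n s => [//|n IH] s.
by rewrite /= t_bound_stepE /= !IH.
Qed.

Lemma t_sumE l : prog_eval t_sum e l = sumn l.
Proof. by elim: l => //= x l <-; rewrite t_addE. Qed.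

Lemma t_lengthE s (l : interp K (SList s)) : prog_eval t_length e l = size l.
Proof. by elim: l => //= x l <-. Qed.
End Specs.
Opaque t_bound t_sum t_length.

(** The sum of all the exponents of all the monomials, which bounds the degree
    of each of the polynomials and the degree of their product. *)
Definition total (K : fieldType) (ps : seq (seq (seq nat * K))) : nat :=
  sumn [seq sumn [seq sumn mc.1 | mc <- p] | p <- ps].

Lemma t_totalE (K : fieldType) G (e : penv K G) (ps : interp K (SList SPoly)) :
  prog_eval t_total e ps = total ps.
Proof.
rewrite /= t_sumE t_mapE; congr sumn; apply: eq_map => p.
by rewrite t_sumE t_mapE; congr sumn; apply: eq_map => mc; rewrite t_sumE.
Qed.
Opaque t_total.

Lemma decode_deg (K : fieldType) n (p : interp K SPoly) :
  deg_le (sumn [seq sumn mc.1 | mc <- p]) (decode n p).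
Proof.
elim: p => [|[l c] p IH] /=; first by rewrite decode_nil deg_le0.
rewrite decode_cons; apply: deg_leD; last by apply: deg_leW IH; apply: leq_addl.
rewrite -mul_mpolyC; apply: (@deg_leW _ _ (0 + sumn l)); first exact: leq_addr.
apply: deg_leM; first exact: deg_leC.
rewrite /deg_le msizeX ltnS mdegE {p IH c}/=.
under eq_bigr do rewrite mnmE.
elim: n l => [|n IH] [|x l]; rewrite ?big_ord0 ?big_ord_recl //=.
  by rewrite big1 // => i _; rewrite nth_nil.
by rewrite leq_add2l IH.
Qed.

Lemma total_deg (K : fieldType) n (ps : interp K (SList SPoly)) :
  (forall p, p \in map (decode n) ps -> deg_le (total ps) p) /\
  deg_le (total ps) (\prod_(p <- map (decode n) ps) p).
Proof.
elim: ps => [|p ps [IH1 IH2]]; first by split=> //; rewrite big_nil deg_le1.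
rewrite /total /= -/(total ps); split=> [q|].
  rewrite inE => /orP[/eqP ->|/IH1 q_deg].
    by apply: deg_leW (decode_deg n p); apply: leq_addr.
  by apply: deg_leW q_deg; apply: leq_addl.
by rewrite big_cons; apply: deg_leM => //; apply: decode_deg.
Qed.

(** * Gaussian elimination with cofactors *)

(** A polynomial together with the list of the pairs (a, p), with p among the
    given generators, whose products account for it or, in the case of the
    target, for its difference with the polynomial to be expressed. *)
Definition SItem : Defs.sort := SProd SPoly (SList (SProd SPoly SPoly)).
Definition SState : Defs.sort := SProd (SList SItem) SItem.

Section Programs.
Variable G : seq Defs.sort.

Definition t_comb : prog G (SItem --> SItem --> SFld --> SItem) :=
  lam (lam (lam (pair (t_cat $ fst v2 $ (t_scale $ v0 $ fst v1))
    (t_cat $ snd v2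
       $ (t_map $ lam (pair (t_scale $ v1 $ fst v0) (snd v0)) $ snd v1))))).

Definition t_pivot : prog G (SNat --> SList SNat --> SList SItem --> SOpt SItem) :=
  lam (lam (PListRec _ _ _ $ PNone _ _
    $ lam (lam (lam (PFIsZero _ _ $ (t_coef $ v4 $ v3 $ fst v2)
                       $ v0 $ (PSome _ _ $ v2)))))).

End Programs.
Arguments t_comb {G}.
Arguments t_pivot {G}.

Definition t_reduce {G} :
    prog G (SNat --> SList SNat --> SItem --> SItem --> SItem) :=
  lam (lam (lam (lam (t_comb $ v0 $ v1
    $ (PFMul _ $ (t_coef $ v3 $ v2 $ fst v0)
         $ (PFOpp _ $ (PFInv _ $ (t_coef $ v3 $ v2 $ fst v1)))))))).

(** The pivot is reduced with the other items, and so becomes 0: no item has to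
    be removed, and one step is the same linear map on all the items. *)
Definition t_step {G} : prog G (SNat --> SList SNat --> SState --> SState) :=
  lam (lam (lam (POptCase _ _ _ $ v0
    $ lam (pair (t_map $ (t_reduce $ v3 $ v2 $ v0) $ fst v1)
                (t_reduce $ v3 $ v2 $ v0 $ snd v1))
    $ (t_pivot $ v2 $ v1 $ fst v0)))).

Section Elimination.
Variables (K : fieldType) (n : nat) (gens : seq {mpoly K[n]}).
Local Notation item := (interp K SItem).

Definition value (u : item) : {mpoly K[n]} := decode n u.1.

Definition cofactors (u : item) : seq ({mpoly K[n]} * {mpoly K[n]}) :=
  [seq (decode n ap.1, decode n ap.2) | ap <- u.2].

Definition accounted (m : {mpoly K[n]}) (u : item) : Prop :=
  value u = m + \sum_(ap <- cofactors u) ap.1 * ap.2 /\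
  {subset unzip2 (cofactors u) <= gens}.

Section Specs.
Variables (G : seq Defs.sort) (e : penv K G).

Lemma t_comb_value u v c :
  value (prog_eval t_comb e u v c) = value u + c *: value v.
Proof. by rewrite /value /= t_catE decode_cat t_scaleE. Qed.

Lemma t_comb_cofactors u v c : cofactors (prog_eval t_comb e u v c) =
  cofactors u ++ [seq (c *: ap.1, ap.2) | ap <- cofactors v].
Proof.
rewrite /cofactors /= t_catE t_mapE map_cat -!map_comp; congr (_ ++ _).
by apply: eq_map => ap /=; rewrite t_scaleE.
Qed.

Lemma t_comb_accounted m u v c : accounted m u -> accounted 0 v ->
  accounted m (prog_eval t_comb e u v c).
Proof.
move=> [uE u_gens] [vE v_gens]; split.
  rewrite t_comb_value t_comb_cofactors big_cat uE vE add0r scaler_sumr -addrA.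
  congr (_ + (_ + _)); rewrite [RHS]big_map; apply: eq_bigr => ap _ /=.
  by rewrite scalerAl.
have unzipE : unzip2 [seq (c *: ap.1, ap.2) | ap <- cofactors v] =
    unzip2 (cofactors v) by rewrite /unzip2 -map_comp.
move=> p; rewrite t_comb_cofactors /unzip2 map_cat mem_cat -!/(unzip2 _) unzipE.
by case/orP; [exact: u_gens | exact: v_gens].
Qed.

Lemma t_pivotP l us :
  match prog_eval t_pivot e n l us with
  | Some v => List.In v us /\ (value v)@_(mono n l) != 0
  | None => forall u, List.In u us -> (value u)@_(mono n l) = 0
  end.
Proof.
elim: us => [//|u us IH] /=; rewrite t_coefE -/(value u).
case: eqP => [u0|/eqP u_neq0]; last by split; [left|].
rewrite /= in IH; case: (list_rect _ _ _ us) IH => [v|] IH.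
  by case: IH => us_v v0; split=> //; right.
by move=> u1 [<- //|]; apply: IH.
Qed.

End Specs.
Opaque t_comb t_pivot.

Definition reduce (m0 : 'X_{1..n}) (v p : {mpoly K[n]}) : {mpoly K[n]} :=
  p + (p@_m0 * - (v@_m0)^-1) *: v.

Lemma reduce_linear m0 v : linear (reduce m0 v).
Proof.
move=> c p q; rewrite /reduce mcoeffD mcoeffZ scalerDr scalerA.
by rewrite addrACA -scalerDl; congr (_ + _ *: _); ring.
Qed.

Lemma reduce_kills m0 v p : v@_m0 != 0 -> (reduce m0 v p)@_m0 = 0.
Proof.
by move=> v0; rewrite mcoeffD mcoeffZ mulrN mulNr -mulrA mulVf ?mulr1 ?subrr.
Qed.

Lemma reduce_zero m0 v p m : v@_m = 0 -> p@_m = 0 -> (reduce m0 v p)@_m = 0.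
Proof. by move=> vm pm; rewrite mcoeffD mcoeffZ vm pm mulr0 addr0. Qed.

(** The impredicative form spares naming the coefficients of a combination. *)
Definition in_span (vs : seq {mpoly K[n]}) (w : {mpoly K[n]}) : Prop :=
  forall P : {mpoly K[n]} -> Prop, P 0 ->
    (forall c x y, P x -> P y -> P (c *: x + y)) ->
    (forall v, v \in vs -> P v) -> P w.

Lemma in_span_linear vs w (f : {mpoly K[n]} -> {mpoly K[n]}) :
  linear f -> in_span vs w -> in_span (map f vs) (f w).
Proof.
move=> f_lin vs_w P P0 P_lin Pvs; apply: (vs_w (fun x => P (f x))).
- have := f_lin 0 0 0; rewrite !scale0r !add0r => E.
  by have := f_lin (-1) 0 0; rewrite scaler0 addr0 scaleN1r addNr => ->.
- by move=> c x y Px Py; rewrite f_lin; apply: P_lin.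
- by move=> v /(map_f f); apply: Pvs.
Qed.

Definition values (us : seq item) : seq {mpoly K[n]} := map value us.

(** What is needed of one step.  If no item has the monomial m0 there is no
    pivot, and the linear map f is the identity. *)
Definition eliminates (m0 : 'X_{1..n}) (st st' : interp K SState) : Prop :=
  exists f : {mpoly K[n]} -> {mpoly K[n]},
    [/\ linear f,
        values st'.1 = map f (values st.1) /\ value st'.2 = f (value st.2),
        forall m p, (forall v, v \in values st.1 -> v@_m = 0) ->
          p@_m = 0 -> (f p)@_m = 0 &
        forall v, v \in values st.1 -> (f v)@_m0 = 0].

Definition state_accounted (m : {mpoly K[n]}) (st : interp K SState) : Prop :=
  (forall u, List.In u st.1 -> accounted 0 u) /\ accounted m st.2.

Section Specs.
Variables (G : seq Defs.sort) (e : penv K G).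

Lemma In_values u us : List.In u us -> value u \in values us.
Proof.
by elim: us => //= u' us IH [->|/IH us_u]; rewrite inE ?eqxx // us_u orbT.
Qed.

Lemma t_reduce_value l v u :
  value (prog_eval t_reduce e n l v u) = reduce (mono n l) (value v) (value u).
Proof. by rewrite /= t_comb_value !t_coefE. Qed.

Lemma t_reduce_accounted m l v u : accounted m u -> accounted 0 v ->
  accounted m (prog_eval t_reduce e n l v u).
Proof. by move=> um v0; rewrite /=; apply: t_comb_accounted. Qed.

End Specs.
Opaque t_reduce.

Lemma t_step_eliminates G (e : penv K G) l (st : interp K SState) :
  eliminates (mono n l) st (prog_eval t_step e n l st).
Proof.
case: st => us w; rewrite /=.
have := @t_pivotP [:: SState, SList SNat, SNat & G] ((us, w), (l, (n, e))) l us.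
case: (prog_eval t_pivot _ n l us) => [v [us_v v_l]|us_l] /=; last first.
  exists id; split=> //; first by rewrite /values map_id.
  by move=> v; elim: us us_l => //= u us IH us_l; rewrite inE => /orP[/eqP ->|];
    [apply: us_l; left | apply: IH => u' us_u'; apply: us_l; right].
exists (reduce (mono n l) (value v)); split.
- exact: reduce_linear.
- rewrite t_reduce_value t_mapE /values -!map_comp; split=> //.
  by apply: eq_map => u /=; rewrite t_reduce_value.
- by move=> m p usm pm; apply: reduce_zero => //; apply: usm; apply: In_values.
- by move=> p _; apply: reduce_kills.
Qed.

Lemma t_step_accounted G (e : penv K G) m l (st : interp K SState) :
  state_accounted m st -> state_accounted m (prog_eval t_step e n l st).
Proof.
case: st => us w [us_acc w_acc]; rewrite /=.
have := @t_pivotP [:: SState, SList SNat, SNat & G] ((us, w), (l, (n, e))) l us.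
case: (prog_eval t_pivot _ n l us) => [v [us_v _]|_] //=.
split=> /=; last by apply: t_reduce_accounted => //; apply: us_acc.
move=> u; rewrite t_mapE => /List.in_map_iff[u' [<- us_u']].
by apply: t_reduce_accounted; apply: us_acc.
Qed.
Opaque t_step.

Definition t_eliminate {G} :
    prog G (SNat --> SState --> SList (SList SNat) --> SState) :=
  lam (lam (PListRec _ _ _ $ v0 $ lam (lam (lam (t_step $ v4 $ v2 $ v0))))).

(** A monomial once eliminated does not come back, since later steps combine
    items without this monomial.  The target is reduced like the items, but the
    monomials eliminated from these can survive in it. *)
Lemma t_eliminateP G (e : penv K G) (m : {mpoly K[n]}) (st : interp K SState)
    (ls : seq (seq nat)) (st' := prog_eval t_eliminate e n st ls) :
    state_accounted m st ->
  [/\ state_accounted m st',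
      in_span (values st.1) (value st.2) -> in_span (values st'.1) (value st'.2),
      forall m0, (forall v, v \in values st.1 -> v@_m0 = 0) ->
        forall v, v \in values st'.1 -> v@_m0 = 0,
      forall m0, (forall v, v \in values st.1 -> v@_m0 = 0) ->
        (value st.2)@_m0 = 0 -> (value st'.2)@_m0 = 0 &
      forall l, l \in ls -> forall v, v \in values st'.1 -> v@_(mono n l) = 0].
Proof.
move=> st_acc; rewrite {}/st'; elim: ls => [//|l ls [acc span zeros zero kills]] /=.
move: acc span zeros zero kills; rewrite /=.
set st1 := list_rect _ _ _ ls => acc span zeros zero kills.
set st2 := prog_eval t_step _ _ _ _.
have [f [f_lin [fE1 fE2] f_zero f_kills]] : eliminates (mono n l) st1 st2.
  exact: t_step_eliminates.
have f_values m0 : (forall v, v \in values st1.1 -> v@_m0 = 0) ->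
    forall v, v \in values st2.1 -> v@_m0 = 0.
  by move=> zm v; rewrite fE1 => /mapP[p p1 ->]; apply: f_zero => //; apply: zm.
split.
- exact: t_step_accounted.
- by move=> /span; rewrite fE1 fE2; apply: in_span_linear.
- by move=> m0 zm; apply: f_values; apply: zeros.
- by move=> m0 zm wm; rewrite fE2; apply: f_zero; [apply: zeros | apply: zero].
- move=> l'; rewrite inE => /orP[/eqP ->|l'_ls]; last first.
    by apply: f_values; apply: kills.
  by move=> v; rewrite fE1 => /mapP[p p1 ->]; apply: f_kills.
Qed.
Opaque t_eliminate.

Definition t_vanish {G s} :
    prog G (SNat --> SPoly --> s --> s --> SList (SList SNat) --> s) :=
  lam (lam (lam (lam (PListRec _ _ _ $ v1
    $ lam (lam (lam (PFIsZero _ _ $ (t_coef $ v6 $ v2 $ v5) $ v0 $ v3))))))).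

Lemma t_vanishE G (e : penv K G) s p (a b : interp K s) (ls : seq (seq nat)) :
  prog_eval t_vanish e n p a b ls =
  if all (fun l => (decode n p)@_(mono n l) == 0) ls then a else b.
Proof.
elim: ls => //= l ls ->; rewrite t_coefE.
by case: (_ == 0); case: all.
Qed.
Opaque t_vanish.

Definition t_item {G} : prog G (SPoly --> SList SNat --> SItem) :=
  lam (lam (lam (pair (t_pmul $ v0 $ v2) (pcons (pair v0 v2) (PNil _ _)))
    $ pcons (pair v0 (PFOne _)) (PNil _ _))).

Definition t_items {G} :
    prog G (SList SPoly --> SList (SList SNat) --> SList SItem) :=
  lam (lam (t_flatten $ (t_map $ lam (t_map $ (t_item $ v0) $ v1) $ v1))).

Lemma t_itemP G (e : penv K G) (p : interp K SPoly) l
    (u := prog_eval t_item e p l) :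
  value u = 'X_[mono n l] * decode n p /\ (decode n p \in gens -> accounted 0 u).
Proof.
have dE : decode n ([:: (l, 1)] : interp K SPoly) = 'X_[mono n l].
  by rewrite decode_cons decode_nil addr0 scale1r.
have uE : value u = 'X_[mono n l] * decode n p by rewrite /value /= t_pmulE dE.
split=> // p_gens; split; first by rewrite uE /cofactors /= big_seq1 add0r dE.
by move=> q; rewrite /cofactors /= inE => /eqP ->.
Qed.
Opaque t_item.

Lemma t_itemsP G (e : penv K G) (r0 : interp K (SList SPoly)) (box : seq (seq nat))
    (us := prog_eval t_items e r0 box) : {subset map (decode n) r0 <= gens} ->
  (forall u, List.In u us -> accounted 0 u) /\
  (forall p l, p \in map (decode n) r0 -> l \in box ->
     'X_[mono n l] * p \in values us).
Proof.
rewrite {}/us /= t_flattenE t_mapE; move: (r0, e) => env.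
elim: r0 => [|p r0 IH] sub //.
have [|IH1 IH2] := IH; first by move=> q qr; apply: sub; rewrite /= inE qr orbT.
split.
  move=> u /= /List.in_app_iff[|/IH1 //]; rewrite t_mapE.
  case/List.in_map_iff => l [<- _]; apply: (t_itemP _ p l).2.
  by apply: sub; rewrite /= inE eqxx.
move=> q l; rewrite inE => /orP[/eqP ->|q_r0] l_box; last first.
  by rewrite /values map_cat mem_cat [X in _ || X]IH2 ?orbT.
rewrite /values map_cat mem_cat t_mapE; apply/orP; left; rewrite -map_comp.
by apply/mapP; exists l => //=; rewrite (t_itemP _ p l).1.
Qed.
Opaque t_items.
End Elimination.

Opaque t_comb t_pivot t_reduce t_step t_eliminate t_vanish t_item t_items.

(** * Solving the linear system *)

(** The monomials written in the items are the only ones to be eliminated: the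
    other ones have the coefficient 0 from the beginning, and keep it. *)
Definition t_coords {G} : prog G (SList SItem --> SList (SList SNat)) :=
  lam (t_flatten $ (t_map $ lam (t_map $ lam (fst v0) $ fst v0) $ v0)).

Lemma t_coordsP (K : fieldType) n G (e : penv K G) (us : interp K (SList SItem)) m :
  (forall l, l \in (prog_eval t_coords e us : seq (seq nat)) -> mono n l != m) ->
  forall v, v \in values n us -> v@_m = 0.
Proof.
rewrite /= t_flattenE t_mapE; move: (us, e) => env.
elim: us => //= u us IH us_m v; rewrite inE => /orP[/eqP ->|]; last first.
  by apply: IH => l us_l; apply: us_m; rewrite mem_cat us_l orbT.
have {us_m IH} : forall l, l \in [seq mc.1 | mc <- u.1] -> mono n l != m.
  by move=> l u_l; apply: us_m; rewrite mem_cat t_mapE u_l.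
rewrite /value; elim: (u.1) => [|mc r IH] u_m; first by rewrite decode_nil mcoeff0.
rewrite decode_cons mcoeffD mcoeffZ mcoeffX (negPf (u_m _ _)); last first.
  by rewrite inE eqxx.
by rewrite mulr0 add0r IH // => l r_l; apply: u_m; rewrite inE r_l orbT.
Qed.
Opaque t_coords.

(** The cofactors of an item reduced from m to 0 account for - m, whence the
    change of sign. *)
Definition t_read {G} : prog G (SNat --> SList (SList SNat) --> SItem
    --> SOpt (SList (SProd SPoly SPoly))) :=
  lam (lam (lam (t_vanish $ v2 $ fst v0
    $ (PSome _ _ $ (t_map $ lam (pair (t_scale $ (PFOpp _ $ PFOne _) $ fst v0)
                                     (snd v0)) $ snd v0))
    $ PNone _ _ $ v1))).

Lemma t_readE (K : fieldType) n G (e : penv K G) (ls : seq (seq nat)) w :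
  exists2 aps : interp K (SList (SProd SPoly SPoly)),
    prog_eval t_read e n ls w =
      if all (fun l => (value n w)@_(mono n l) == 0) ls then Some aps else None &
    [seq (decode n ap.1, decode n ap.2) | ap <- aps] =
      [seq (- ap.1, ap.2) | ap <- cofactors n w].
Proof.
rewrite /= t_vanishE; eexists; first by [].
rewrite t_mapE /cofactors -!map_comp; apply: eq_map => ap /=.
by rewrite t_scaleE scaleN1r.
Qed.
Opaque t_read.

Definition t_reduce_read {G} : prog G (SNat --> SState --> SList (SList SNat)
    --> SOpt (SList (SProd SPoly SPoly))) :=
  lam (lam (lam (t_read $ v2 $ v0 $ snd (t_eliminate $ v2 $ v1 $ v0)))).

Definition t_express {G} : prog G (SNat --> SPoly --> SList SItem
    --> SOpt (SList (SProd SPoly SPoly))) :=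
  lam (lam (lam (t_reduce_read $ v2 $ pair v0 (pair v1 (PNil _ _))
    $ (t_coords $ pcons (pair v1 (PNil _ _)) v0)))).

Definition t_solve {G} : prog G (SNat --> SList SPoly --> SPoly
    --> SList (SList SNat) --> SOpt (SList (SProd SPoly SPoly))) :=
  lam (lam (lam (lam (t_express $ v3 $ v1 $ (t_items $ v2 $ v0))))).

Section Solve.
Variables (K : fieldType) (n : nat).

Lemma t_reduce_readP gens G (e : penv K G) (m : {mpoly K[n]}) (st : interp K SState)
    (ls : seq (seq nat)) : state_accounted gens m st ->
    (forall m0, ~ (exists2 l, l \in ls & mono n l = m0) ->
       (forall v, v \in values n st.1 -> v@_m0 = 0) /\ (value n st.2)@_m0 = 0) ->
  match prog_eval t_reduce_read e n st ls with
  | Some aps =>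
      let pairs := [seq (decode n ap.1, decode n ap.2) | ap <- aps] in
      {subset unzip2 pairs <= gens} /\ m = \sum_(ap <- pairs) ap.1 * ap.2
  | None => ~ in_span (values n st.1) (value n st.2)
  end.
Proof.
move=> st_acc outside; rewrite /=; set st' := prog_eval t_eliminate _ _ _ _.
have [[_ [wE w_gens]] span zeros zero kills] := 
  @t_eliminateP K n gens [:: SList (SList SNat), SState, SNat & G] (ls, (st, (n, e)))
    m st ls st_acc.
have [aps -> pairsE] :=
  @t_readE K n [:: SList (SList SNat), SState, SNat & G] (ls, (st, (n, e))) ls st'.2.
case: ifP => [/allP all0|not_all0]; last first.
  move=> us_m; case/negP: not_all0; apply/allP => l _.
  suff -> : value n st'.2 = 0 by rewrite mcoeff0.
  apply: (span us_m (fun p => p = 0)) => [//|c x y -> ->|v st'_v].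
    by rewrite scaler0 addr0.
  apply/mpolyP => m0; rewrite mcoeff0.
  have [[l' l'_ls <-]|none] := classic (exists2 l', l' \in ls & mono n l' = m0).
    exact: kills l'_ls _ st'_v.
  by apply: zeros st'_v; apply: (proj1 (outside _ none)).
have w0 : value n st'.2 = 0.
  apply/mpolyP => m0; rewrite mcoeff0.
  have [[l' l'_ls <-]|none] := classic (exists2 l', l' \in ls & mono n l' = m0).
    exact/eqP/all0.
  by have [us0 m00] := outside _ none; apply: zero.
rewrite pairsE; split.
  by rewrite /unzip2 -map_comp; apply: w_gens.
move/eqP: w0; rewrite wE addr_eq0 => /eqP ->; rewrite [RHS]big_map -sumrN.
by apply: eq_bigr => ap _; rewrite mulNr.
Qed.
Opaque t_reduce_read.

Lemma t_expressP gens G (e : penv K G) (m : interp K SPoly)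
    (us : interp K (SList SItem)) :
    (forall u, List.In u us -> accounted gens (0 : {mpoly K[n]}) u) ->
  match prog_eval t_express e n m us with
  | Some aps =>
      let pairs := [seq (decode n ap.1, decode n ap.2) | ap <- aps] in
      {subset unzip2 pairs <= gens} /\ decode n m = \sum_(ap <- pairs) ap.1 * ap.2
  | None => ~ in_span (values n us) (decode n m)
  end.
Proof.
move=> us_acc; rewrite /=; set ls := prog_eval t_coords _ _.
apply: (@t_reduce_readP gens [:: SList SItem, SPoly, SNat & G] (us, (m, (n, e)))
  (decode n m) (us, (m, [::])) ls).
  by split=> //; split=> //=; rewrite big_nil addr0.
move=> m0 none; have zm := @t_coordsP K n [:: SList SItem, SPoly, SNat & G]
  (us, (m, (n, e))) ((m, [::]) :: us) m0.
have {none}zm : forall v, v \in decode n m :: values n us -> v@_m0 = 0.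
  by apply: zm => l l_ls; apply/eqP => lE; apply: none; exists l.
split; last by apply: zm; rewrite inE eqxx.
by move=> v us_v; apply: zm; rewrite inE us_v orbT.
Qed.
Opaque t_express.

(** A negative answer excludes only the combinations whose multipliers are
    spanned by the monomials of the box; the degree bound makes this enough. *)
Lemma t_solveP G (e : penv K G) (r0 : interp K (SList SPoly))
    (m : interp K SPoly) (box : seq (seq nat)) (R0 := map (decode n) r0) :
  match prog_eval t_solve e n r0 m box with
  | Some aps =>
      let pairs := [seq (decode n ap.1, decode n ap.2) | ap <- aps] in
      {subset unzip2 pairs <= R0} /\ decode n m = \sum_(ap <- pairs) ap.1 * ap.2
  | None => forall a : 'I_(size R0) -> {mpoly K[n]},
      (forall i m0, (a i)@_m0 != 0 -> exists2 l, l \in box & mono n l = m0) ->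
      decode n m <> \sum_i a i * R0`_i
  end.
Proof.
rewrite /=; set us := prog_eval t_items _ _ _.
have [us_acc us_values] : (forall u, List.In u us -> accounted R0 0 u) /\
    (forall p l, p \in R0 -> l \in box -> 'X_[mono n l] * p \in values n us).
  exact: t_itemsP.
have := @t_expressP R0 [:: SList (SList SNat), SPoly, SList SPoly, SNat & G]
  (box, (m, (r0, (n, e)))) m us us_acc.
case: (prog_eval t_express _ _ _ _) => // not_span a a_box mE; apply: not_span.
move=> P P0 P_lin Pus.
have P_sum (J : Type) (r : seq J) (F : J -> {mpoly K[n]}) :
    (forall j, P (F j)) -> P (\sum_(j <- r) F j).
  move=> PF; elim: r => [|j r IH]; first by rewrite big_nil.
  by rewrite big_cons -[F j]scale1r; apply: P_lin.
rewrite mE; apply: (P_sum) => i; rewrite [a i]mpolyE mulr_suml.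
rewrite big_seq_cond big_mkcond; apply: (P_sum) => m0.
case: ifP => // /andP[m0_a _].
have [|l' l'_box <-] := a_box i m0; first by rewrite -mcoeff_msupp.
rewrite -scalerAl -[_ *: _]addr0; apply: P_lin => //; apply: Pus.
by apply: us_values => //; apply: mem_nth.
Qed.
Opaque t_solve.

End Solve.
Opaque t_reduce_read t_express t_solve.

(** * The decision algorithm *)

Definition t_decide_bounded {G} : prog G (SNat --> SList SPoly --> SNat --> SNat
    --> SList SPoly --> SOutput) :=
  lam (lam (lam (lam (lam (POptCase _ _ _ $ PNone _ _ $ lam (PSome _ _ $ pair v1 v0)
    $ (t_solve $ v4 $ v3 $ (t_prod $ v0)
         $ (t_box $ v4
              $ (PSucc _ $ (t_add $ v1 $ (t_mul $ v2 $ (PSucc _ $ v1))))))))))).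

Lemma t_decide_boundedP (K : fieldType) n G (e : penv K G)
    (r0 rn0 : interp K (SList SPoly)) s (B := cert_bound n.+1 s)
    (R0 := map (decode n) r0) (Rn0 := map (decode n) rn0)
    (factors : interp K (SList SPoly)) :
    factors = flatten (nseq B.+1 rn0) -> (size R0 < s)%N ->
    (forall p, p \in R0 -> deg_le s p) ->
    deg_le s.-1 (\prod_(q <- Rn0) q) ->
  match prog_eval t_decide_bounded e n r0 s B factors with
  | None => ~ collapses ACF (dg_presentation R0 Rn0)
  | Some (s, aps) =>
      collapses ACF (dg_presentation R0 Rn0) /\
      let factors : seq {mpoly K[n]} := map (decode n) s in
      let pairs : seq ({mpoly K[n]} * {mpoly K[n]}) :=
        [seq (decode n ap.1, decode n ap.2) | ap <- aps] in
      {subset factors <= Rn0} /\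
      {subset unzip2 pairs <= R0} /\
      \prod_(q <- factors) q = \sum_(ap <- pairs) ap.1 * ap.2
  end.
Proof.
move=> def_factors R0s R0_deg q_deg; rewrite /= t_addE t_mulE.
set m := prog_eval t_prod _ _; set box := prog_eval t_box _ _ _.
have mE : decode n m = \prod_(q <- map (decode n) factors) q.
  by rewrite t_prodE [RHS]big_map.
have factorsE :
    \prod_(q <- map (decode n) factors) q = (\prod_(q <- Rn0) q) ^+ B.+1.
  rewrite def_factors; elim: (B.+1) => [|k IH]; first by rewrite big_nil.
  by rewrite exprS -IH /= map_cat big_cat.
have sub_factors : {subset map (decode n) factors <= Rn0}.
  move=> q; rewrite def_factors; elim: (B.+1) => [//|k IH] /=.
  by rewrite map_cat mem_cat => /orP[|/IH].
have := @t_solveP K n [:: SList SPoly, SNat, SNat, SList SPoly, SNat & G]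
  (factors, (B, (s, (r0, (n, e))))) r0 m box.
case: (prog_eval t_solve _ _ _ _ _) => [aps [sub_pairs pairsE]|no_comb] /=.
  rewrite -mE; split=> //.
  by apply: (certificate_collapses sub_factors sub_pairs); rewrite -mE.
move/(collapse_certificate_bounded R0s R0_deg q_deg) => [a aE a_deg].
apply: (no_comb a); last by rewrite mE factorsE.
move=> i m0 /(deg_leP (a_deg i)) m0_deg; apply: t_boxE => j.
rewrite ltnS; apply: leq_trans m0_deg.
by rewrite mdegE (bigD1 j) //= leq_addr.
Qed.
Opaque t_decide_bounded.

Definition t_decide_degree {G} : prog G (SNat --> SList SPoly --> SList SPoly
    --> SNat --> SOutput) :=
  lam (lam (lam (lam (t_decide_bounded $ v3 $ v2 $ v0
    $ (t_bound $ (PSucc _ $ v3) $ v0)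
    $ (t_rep $ v1 $ (PSucc _ $ (t_bound $ (PSucc _ $ v3) $ v0))))))).

Lemma t_decide_degreeE (K : fieldType) G (e : penv K G) n r0 rn0 s
    (B := cert_bound n.+1 s) : exists (G' : seq Defs.sort) (e' : penv K G'),
  prog_eval t_decide_degree e n r0 rn0 s =
  prog_eval t_decide_bounded e' n r0 s B (flatten (nseq B.+1 rn0)).
Proof.
exists [:: SNat, SList SPoly, SList SPoly, SNat & G], (s, (rn0, (r0, (n, e)))).
by rewrite [LHS]/= t_boundE t_repE.
Qed.
Opaque t_decide_degree.

(** The bound s exceeds the number of equations, because of the additional
    polynomial 1 - t q, and the degrees of the equations and of q. *)
Definition t_decide : algorithm SInput SOutput :=
  lam (lam (PSome _ _ $ (t_decide_degree $ fst v0 $ fst (snd v0) $ snd (snd v0)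
    $ (PSucc _ $ (t_add $ (t_length $ fst (snd v0))
       $ (t_add $ (t_total $ fst (snd v0)) $ (t_total $ snd (snd v0)))))))).

Theorem theorem2p13 :
  exists A : algorithm SInput SOutput,
  forall (K : fieldType) (n : nat) (R0 Rn0 : seq {mpoly K[n]})
         (r0 rn0 : interp K (SList SPoly)),
    map (decode n) r0 = R0 ->
    map (decode n) rn0 = Rn0 ->
    exists out : interp K SOutput,
      @computes SInput SOutput A K (n, (r0, rn0)) out /\
      match out with
      | None => ~ collapses ACF (dg_presentation R0 Rn0)
      | Some (s, aps) =>
          collapses ACF (dg_presentation R0 Rn0) /\
          let factors : seq {mpoly K[n]} := map (decode n) s in
          let pairs : seq ({mpoly K[n]} * {mpoly K[n]}) :=
            [seq (decode n ap.1, decode n ap.2) | ap <- aps] in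
          {subset factors <= Rn0} /\
          {subset unzip2 pairs <= R0} /\
          \prod_(q <- factors) q = \sum_(ap <- pairs) ap.1 * ap.2
      end.
Proof.
exists t_decide => K n _ _ r0 rn0 <- <-.
set s := (size r0 + (total r0 + total rn0)).+1.
have [G [e E]] := t_decide_degreeE
  (((n, (r0, rn0)), (0%N, tt)) : penv K [:: SInput; SNat]) n r0 rn0 s.
set B := cert_bound n.+1 s in E.
exists (prog_eval t_decide_bounded e n r0 s B (flatten (nseq B.+1 rn0))); split.
  exists 0%N; split; last by move=> i; rewrite ltn0.
  by rewrite /= t_addE t_lengthE t_addE !t_totalE -/s E.
have [r0_deg _] := total_deg n r0; have [_ rn0_deg] := total_deg n rn0.
apply: (t_decide_boundedP e (erefl _)).
- by rewrite size_map ltnS leq_addr.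
- by move=> p /r0_deg; apply: deg_leW; rewrite /s; lia.
- by apply: deg_leW rn0_deg; rewrite /s /=; lia.
Qed.
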